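(* Let $\alpha=2$, $n\ge3$ and $\mu>-s_1$. There is a global branch of periodic solutions bifurcating from the polygonal equilibrium $\bar a$, starting at normalized frequency $1$ (i.e. with period $2\pi$ in the time normalized by $\sqrt{\omega}$, so that $\nu=\sqrt\omega$ in the equation of the context), with symmetries $\mathbb{Z}_n(\zeta,\zeta,-n\zeta)\times\mathbb{Z}_2(\kappa)$; that is, along the branch $z_j(t)=0$ for all $j$, $u_0(t)=0$ and $u_{j+1}(t)=e^{ij\zeta}u_1(t)$.
   Context: **Setting.** Newtonian case $\alpha=2$. Let $\zeta=2\pi/n$, $s_k=\frac14\sum_{j=1}^{n-1}\frac{\sin^2(kj\zeta/2)}{\sin^3(j\zeta/2)}$ and $\omega=\mu+s_1>0$. There are $n+1$ bodies $j=0,\dots,n$ with masses $m_0=\mu$, $m_1=\dots=m_n=1$ (for $\mu=0$ the central body is omitted) and positions $x_j=(u_j,z_j)\in\mathbb{C}\times\mathbb{R}\cong\mathbb{R}^3$. Let $\bar I=\mathrm{diag}(1,1,0)$, $\bar J=\mathrm{diag}(J,0)$ with $J=\begin{pmatrix}0&-1\\1&0\end{pmatrix}$, $\mathcal{M}$ and $\bar{\mathcal J}$ the block diagonal matrices with blocks $m_jI$ and $\bar J$, and $V(x)=\frac{\omega}{2}\sum_j m_j\|\bar I x_j\|^2+\sum_{i<j}m_im_j\|x_j-x_i\|^{-1}$. In coordinates rotating with angular speed $\sqrt\omega$, the $2\pi/\nu$-periodic solutions of Newton's equations correspond, after rescaling time, to the $2\pi$-periodic collision-free solutions $x(t)$ of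 $-\nu^2\mathcal{M}\ddot x-2\sqrt{\omega}\,\nu\bar{\mathcal J}\mathcal{M}\dot x+\nabla V(x)=0$. Solutions are taken in $H^2_{2\pi}$ and normalized by $\int_0^{2\pi}\sum_j z_j\,dt=0$. The normalized frequency is $\nu/\sqrt\omega$. The polygonal equilibrium $\bar a$ is $u_0=0$, $u_j=e^{ij\zeta}$ ($1\le j\le n$), $z_j=0$. **Global branch.** An equilibrium $x_*$ has a global bifurcation branch with symmetries $H$ starting at frequency $\nu_*>0$ if a continuum of solutions $(x,\nu)$, all having the symmetries $H$, bifurcates from the orbit of $x_*$ under planar rotations at $\nu=\nu_*$, and this continuum is either *non-admissible*, i.e. (a) the norm of $x$ or the period $2\pi/\nu$ goes to infinity on it, or (b) it ends in a collision path; or else ( *admissible* ) it returns to other bifurcation points (on the same orbit or at other relative equilibria) and the sum of the local degrees at its bifurcation points is zero. The local degree at an equilibrium $x_*$ and frequency $\nu_*$ is the jump of the component of the orthogonal degree associated with $H$: it equals $\sigma\,(N(\nu_*-\rho)-N(\nu_*+\rho))$ for small $\rho>0$. Here $N(\nu)$ is the number of negative eigenvalues of the Hermitian matrix $\nu^2\mathcal{M}-2\nu\sqrt\omega\,(i\bar{\mathcal J})\mathcal{M}+D^2V(x_* )$ on the space of complex vectors $w$ such that $we^{it}+\bar we^{-it}$ has symmetries $H$, and $\sigma$ is the sign of the determinant of $D^2V(x_* )$ on the constant vectors with symmetries $H$ orthogonal to the rotation orbit of $x_*$. *)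

(* Defs.v *)
From HB Require Import structures.
From mathcomp Require Import all_boot all_order all_fingroup all_algebra.
From mathcomp Require Import complex.
From mathcomp Require Import all_classical all_reals all_analysis measurable_realfun.
From mathcomp Require Import ring lra.

Set Implicit Arguments.
Unset Strict Implicit.
Unset Printing Implicit Defensive.

Import Order.TTheory GRing.Theory Num.Theory.
Import numFieldNormedType.Exports.

Local Open Scope classical_set_scope.
Local Open Scope ring_scope.

(* A configuration of [N] bodies is an ['M[R]_(N, 3)]; row [j] is the position
   [x_j = (u_j, z_j)] with [u_j = x j 0 + i x j 1] and [z_j = x j 2]. *)

Section H2_space.
Variables (R : realType) (N : nat).
Notation mu := (@lebesgue_measure R).
Notation period := `[0, 2 * pi]%classic.

(* [x'] is absolutely continuous, hence differentiable a.e.; [derive1n 2 x] is the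
   default value of [lim] on the null set where it is not. *)
Definition isH2 (x : R -> 'M[R]_(N, 3)) : Prop :=
  [/\ forall t, x (t + 2 * pi) = x t,
      forall t, derivable x t 1,
      continuous (derive1 x),
      forall j k, measurable_fun period (fun t => derive1n 2 x t j k) /\
                  (\int[mu]_(t in period) ((derive1n 2 x t j k) ^+ 2)%:E < +oo)%E
    & forall t, 0 <= t <= 2 * pi -> forall j k,
        derive1 x t j k = derive1 x 0 j k + \int[mu]_(s in `[0, t]) derive1n 2 x s j k].

Record H2 := MkH2 { loop :> R -> 'M[R]_(N, 3); loop_isH2 : isH2 loop }.

Definition sqnorm (A : 'M[R]_(N, 3)) : R := \sum_j \sum_k A j k ^+ 2.

Definition h2norm (x : H2) : R :=
  Num.sqrt (\int[mu]_(t in period)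
    (sqnorm (x t) + sqnorm (derive1 x t) + sqnorm (derive1n 2 x t))).

(* The norm of [x - y] (the derivatives of [x - y] are the differences of the
   derivatives, almost everywhere for the second one). *)
Definition h2dist (x y : H2) : R :=
  Num.sqrt (\int[mu]_(t in period)
    (sqnorm (x t - y t) + sqnorm (derive1 x t - derive1 y t)
     + sqnorm (derive1n 2 x t - derive1n 2 y t))).

Definition h2ball (x : H2) (e : R) : set H2 := [set y | h2dist x y < e].

HB.instance Definition _ := gen_eqMixin H2.
HB.instance Definition _ := gen_choiceMixin H2.

Lemma cst_isH2 (a : 'M[R]_(N, 3)) : isH2 (cst a).
Proof.
have d1 : derive1 (cst a : R -> 'M[R]_(N, 3)) = cst 0.
  by apply/funext => t; rewrite derive1_cst.
have d2 : derive1n 2 (cst a : R -> 'M[R]_(N, 3)) = cst 0.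
  by rewrite derive1nS derive1n1 d1; apply/funext => t; rewrite derive1_cst.
split.
- by [].
- by move=> t; exact: derivable_cst.
- by rewrite d1 => t; exact: cvg_cst.
- move=> j k; have e2 t : derive1n 2 (cst a : R -> 'M[R]_(N, 3)) t j k = 0.
    by rewrite d2 /cst mxE.
  split.
    have -> : (fun t => derive1n 2 (cst a : R -> 'M[R]_(N, 3)) t j k) = cst 0.
      by apply/funext.
    exact: measurable_cst.
  under eq_integral do rewrite e2 expr0n /=.
  by rewrite integral0 ltry.
- move=> t _ j k; have e2 s : derive1n 2 (cst a : R -> 'M[R]_(N, 3)) s j k = 0.
    by rewrite d2 /cst mxE.
  under eq_Rintegral do rewrite e2.
  by rewrite d1 /Rintegral integral0 /= addr0.
Qed.

Definition const_loop (a : 'M[R]_(N, 3)) : H2 := MkH2 (cst_isH2 a).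

Local Definition sqint (f : R -> 'M[R]_(N, 3)) : Prop :=
  forall j k, measurable_fun period (fun t => f t j k) /\
              (\int[mu]_(t in period) ((f t j k) ^+ 2)%:E < +oo)%E.

Local Lemma sqint_continuous f : continuous f -> sqint f.
Proof.
move=> cf j k.
have cfjk : continuous (fun t => f t j k : R).
  move=> t; apply: (@continuous_comp _ _ _ f (fun M : 'M[R]_(N, 3) => M j k)).
    exact: cf.
  exact: coord_continuous.
split.
  apply: (@measurable_funS _ _ _ _ setT) => //.
  exact: continuous_measurable_fun.
have : mu.-integrable period (EFin \o (fun t => f t j k ^+ 2)).
  apply: continuous_compact_integrable; first exact: segment_compact.
  apply: continuous_subspaceT => t.
  by apply: cvgM; exact: cfjk.
move/integrableP => [_]; apply: le_lt_trans.
rewrite le_eqVlt; apply/orP; left; apply/eqP; apply: eq_integral => t _ /=.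
by rewrite ger0_norm // sqr_ge0.
Qed.

Local Lemma sqint_integrable f : sqint f ->
  mu.-integrable period (EFin \o (fun t => sqnorm (f t))).
Proof.
move=> sf.
have -> : EFin \o (fun t => sqnorm (f t)) =
  (fun t => \sum_j \sum_k ((f t j k) ^+ 2)%:E).
  apply/funext => t; rewrite /sqnorm /= -sumEFin; apply: eq_bigr => j _.
  by rewrite -sumEFin.
apply: integrable_sum => // j _; apply: integrable_sum => // k _.
have [mf If] := sf j k; apply/integrableP; split.
  by apply/measurable_EFinP; apply: measurable_funX.
apply: le_lt_trans If; rewrite le_eqVlt; apply/orP; left; apply/eqP.
by apply: eq_integral => t _ /=; rewrite ger0_norm // sqr_ge0.
Qed.

Local Lemma sqnorm_ge0 A : 0 <= sqnorm A.
Proof. by apply: sumr_ge0 => j _; apply: sumr_ge0 => k _; exact: sqr_ge0. Qed.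

Local Lemma sqnormN A : sqnorm (- A) = sqnorm A.
Proof.
by apply: eq_bigr => j _; apply: eq_bigr => k _; rewrite mxE sqrrN.
Qed.

Local Lemma young (x y l : R) : 0 < l ->
  (x + y) ^+ 2 <= (1 + l) * x ^+ 2 + (1 + l^-1) * y ^+ 2.
Proof.
move=> l0; have ln0 : l != 0 by rewrite gt_eqF.
rewrite -subr_ge0.
have -> : (1 + l) * x ^+ 2 + (1 + l^-1) * y ^+ 2 - (x + y) ^+ 2 =
  l^-1 * (l * x - y) ^+ 2 by field.
by rewrite mulr_ge0 ?sqr_ge0 // invr_ge0 ltW.
Qed.

Local Lemma sqnormD A B l : 0 < l ->
  sqnorm (A + B) <= (1 + l) * sqnorm A + (1 + l^-1) * sqnorm B.
Proof.
move=> l0; rewrite /sqnorm !mulr_sumr -big_split /=; apply: ler_sum => j _.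
rewrite !mulr_sumr -big_split /=; apply: ler_sum => k _.
by rewrite mxE; exact: young.
Qed.

Local Lemma sqintB f g : sqint f -> sqint g -> sqint (fun t => f t - g t).
Proof.
move=> sf sg j k; have [mf If] := sf j k; have [mg Ig] := sg j k.
have mB : measurable_fun period (fun t => (f t - g t) j k).
  have -> : (fun t => (f t - g t) j k) = (fun t => f t j k - g t j k).
    by apply/funext => t; rewrite !mxE.
  exact: measurable_funB.
split=> //.
have int2 (h : R -> R) : measurable_fun period h ->
    (\int[mu]_(t in period) ((h t) ^+ 2)%:E < +oo)%E ->
    mu.-integrable period (fun t => ((h t) ^+ 2)%:E).
  move=> mh Ih; apply/integrableP; split.
    by apply/measurable_EFinP; apply: measurable_funX.
  apply: le_lt_trans Ih; rewrite le_eqVlt; apply/orP; left; apply/eqP.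
  by apply: eq_integral => t _ /=; rewrite ger0_norm // sqr_ge0.
have I2 : mu.-integrable period
   (fun t => 2%:E * ((f t j k) ^+ 2)%:E + 2%:E * ((g t j k) ^+ 2)%:E)%E.
  by apply: integrableD => //; apply: integrableZl => //; exact: int2.
have : mu.-integrable period (fun t => (((f t - g t) j k) ^+ 2)%:E).
  apply: le_integrable I2 => //.
    by apply/measurable_EFinP; apply: measurable_funX.
  move=> t _ /=; rewrite lee_fin !ger0_norm ?sqr_ge0 //; last first.
    by rewrite addr_ge0 // mulr_ge0 // sqr_ge0.
  rewrite !mxE; have := @young (f t j k) (- g t j k) 1 ltr01.
  by rewrite sqrrN invr1.
move/integrableP => [_]; apply: le_lt_trans.
rewrite le_eqVlt; apply/orP; left; apply/eqP; apply: eq_integral => t _ /=.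
by rewrite ger0_norm // sqr_ge0.
Qed.

Local Definition dens (x y : H2) (t : R) : R :=
  sqnorm (x t - y t) + sqnorm (derive1 x t - derive1 y t)
     + sqnorm (derive1n 2 x t - derive1n 2 y t).

Local Lemma dens_ge0 x y t : 0 <= dens x y t.
Proof. by rewrite !addr_ge0 // sqnorm_ge0. Qed.

Local Lemma H2_sqint (x : H2) :
  [/\ sqint x, sqint (derive1 x) & sqint (derive1n 2 x)].
Proof.
have [_ dx cx sx _] := loop_isH2 x.
have s2 : sqint (derive1n 2 x) by move=> j k; exact: sx.
have s1 : sqint (derive1 x).
  apply: sqint_continuous.
  exact: cx.
have cx0 : continuous x.
  move=> t.
  have := dx t.
  move/derivable1_diffP.
  exact: differentiable_continuous.
have s0 : sqint x.
  apply: sqint_continuous.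
  exact: cx0.
by split.
Qed.

Local Lemma dens_integrable x y : mu.-integrable period (EFin \o dens x y).
Proof.
have [x0 x1 x2] := H2_sqint x; have [y0 y1 y2] := H2_sqint y.
have I0 := sqint_integrable (sqintB x0 y0).
have I1 := sqint_integrable (sqintB x1 y1).
have I2 := sqint_integrable (sqintB x2 y2).
have I01 : mu.-integrable period
    ((EFin \o (fun t => sqnorm (x t - y t))) \+
     (EFin \o (fun t => sqnorm (derive1 x t - derive1 y t))))%E.
  by apply: integrableD; [exact: measurable_itv | exact: I0 | exact: I1].
suff : mu.-integrable period
    (((EFin \o (fun t => sqnorm (x t - y t))) \+
      (EFin \o (fun t => sqnorm (derive1 x t - derive1 y t)))) \+
     (EFin \o (fun t => sqnorm (derive1n 2 x t - derive1n 2 y t))))%E by [].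
by apply: integrableD; [exact: measurable_itv | exact: I01 | exact: I2].
Qed.

Local Lemma dens_young x y z l t : 0 < l ->
  dens x z t <= (1 + l) * dens x y t + (1 + l^-1) * dens y z t.
Proof.
move=> l0; rewrite /dens.
have D (A B C : 'M[R]_(N, 3)) : sqnorm (A - C) <=
    (1 + l) * sqnorm (A - B) + (1 + l^-1) * sqnorm (B - C).
  by have := sqnormD (A - B) (B - C) l0; rewrite addrA subrK.
by rewrite !mulrDr addrACA (addrACA ((1 + l) * _)) !lerD.
Qed.

Local Lemma sqnormB A B : sqnorm (A - B) = sqnorm (B - A).
Proof. by rewrite -(opprB A B) sqnormN. Qed.

Local Lemma dens_sym x y : dens x y = dens y x.
Proof.
apply/funext => t; exact: (f_equal2 +%R
  (f_equal2 +%R (sqnormB (x t) (y t)) (sqnormB (derive1 x t) (derive1 y t)))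
  (sqnormB (derive1n 2 x t) (derive1n 2 y t))).
Qed.

Local Definition densI (x y : H2) : R := \int[mu]_(t in period) dens x y t.

Local Lemma h2distE x y : h2dist x y = Num.sqrt (densI x y).
Proof. by []. Qed.

Local Lemma h2dist_sym x y : h2dist x y = h2dist y x.
Proof. by rewrite !h2distE /densI dens_sym.
Qed.

Local Lemma h2ball_center x (e : R) : 0 < e -> h2ball x e x.
Proof.
move=> e0; rewrite /h2ball /= h2distE /densI.
have -> : dens x x = cst 0.
  apply/funext => t; rewrite /dens !subrr /cst.
  suff -> : sqnorm 0 = 0 by rewrite !addr0.
  by apply: big1 => j _; apply: big1 => k _; rewrite mxE expr0n.
by rewrite /Rintegral integral0 /= sqrtr0.
Qed.

Local Lemma h2ball_sym x y (e : R) : h2ball x e y -> h2ball y e x.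
Proof. by rewrite /h2ball /= h2dist_sym. Qed.

Local Lemma densI_young x y z l : 0 < l ->
  densI x z <= (1 + l) * densI x y + (1 + l^-1) * densI y z.
Proof.
move=> l0.
have Z u v c : mu.-integrable period (EFin \o (fun t => c * dens u v t)).
  suff : mu.-integrable period
    (fun t => c%:E * (EFin \o dens u v) t)%E by [].
  by apply: integrableZl => //; exact: dens_integrable.
rewrite /densI -!RintegralZl //; try exact: dens_integrable.
rewrite -RintegralD //.
apply: le_Rintegral => //; first exact: dens_integrable.
  suff : mu.-integrable period
    ((EFin \o (fun t => (1 + l) * dens x y t)%R) \+
     (EFin \o (fun t => (1 + l^-1) * dens y z t)%R))%E by [].
  by apply: integrableD => //; exact: Z.
by move=> t _; exact: dens_young.
Qed.

Local Lemma h2ball_triangle x y z (a b : R) :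
  h2ball x a y -> h2ball y b z -> h2ball x (a + b) z.
Proof.
rewrite /h2ball /= => xy yz.
have a0 : 0 < a by exact: le_lt_trans (sqrtr_ge0 _) xy.
have b0 : 0 < b by exact: le_lt_trans (sqrtr_ge0 _) yz.
have ab0 : 0 < a + b by rewrite addr_gt0.
have I_ge0 u v : 0 <= densI u v.
  by apply: Rintegral_ge0 => t _; exact: dens_ge0.
have lt_sq u v c : 0 < c -> h2dist u v < c -> densI u v < c ^+ 2.
  move=> c0; rewrite h2distE => uvc; rewrite -(sqr_sqrtr (I_ge0 u v)).
  by rewrite ltr_pXn2r // ?nnegrE ?sqrtr_ge0 ?ltW.
have Aa := lt_sq _ _ _ a0 xy; have Bb := lt_sq _ _ _ b0 yz.
pose l := b / a; have l0 : 0 < l by rewrite divr_gt0.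
have -> : a + b = Num.sqrt ((a + b) ^+ 2) by rewrite sqrtr_sqr gtr0_norm.
rewrite h2distE ltr_sqrt ?exprn_gt0 //.
apply: le_lt_trans (densI_young x y z l0) _.
have -> : (a + b) ^+ 2 = (1 + l) * a ^+ 2 + (1 + l^-1) * b ^+ 2.
  by rewrite /l; field; rewrite !gt_eqF.
by rewrite ltrD // ltr_pM2l // addr_gt0 // invr_gt0.
Qed.

HB.instance Definition _ :=
  hasNbhs.Build H2 (nbhs_ (entourage_ h2ball)).
HB.instance Definition _ := @Nbhs_isPseudoMetric.Build R H2
  (entourage_ h2ball) erefl h2ball
  h2ball_center h2ball_sym h2ball_triangle erefl.

End H2_space.

(* Directional derivatives along the elementary matrices are the partial
   derivatives; the Hessian is indexed by the coordinates of [mxvec]. *)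
Definition gradient (R : realType) (N : nat) (V : 'M[R]_(N, 3) -> R)
    (x : 'M[R]_(N, 3)) : 'M[R]_(N, 3) :=
  \matrix_(j, k) 'D_(delta_mx j k) V x.

Definition hessian (R : realType) (N : nat) (V : 'M[R]_(N, 3) -> R)
    (x : 'M[R]_(N, 3)) : 'M[R]_(N * 3) :=
  \matrix_(r, s) 'D_(vec_mx (delta_mx 0 r))
                   (fun y => 'D_(vec_mx (delta_mx 0 s)) V y) x.

Section linear_algebra.
Variable F : fieldType.

(* A matrix whose row space is the linear subspace [P]. *)
Definition subspace_mx (d : nat) (P : set 'rV[F]_d) : 'M[F]_d :=
  xget 0 [set B | forall v, (v <= B)%MS <-> P v].

(* The operator [w |-> A w] (column vectors) on the invariant subspace [P];
   [restrictmx] acts on row vectors, whence the transpose. *)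
Definition restriction (d : nat) (P : set 'rV[F]_d) (A : 'M[F]_d) :=
  restrictmx (subspace_mx P) A^T.

End linear_algebra.

(* Eigenvalues with multiplicities. *)
Definition eigenvalues (C : closedFieldType) (d : nat) (A : 'M[C]_d) : seq C :=
  sval (closed_field_poly_normal (char_poly A)).

(* [a < 0] in [R[i]] means that [a] is real and negative. *)
Definition n_neg_eigenvalues (R : realType) (d : nat) (A : 'M[R[i]]_d) : nat :=
  count (fun a => a < 0) (eigenvalues A).

Section three_dim.
Variable R : realType.

Definition mx3 (l : seq (seq R)) : 'M[R]_3 :=
  \matrix_(i, j) nth 0 (nth [::] l i) j.

Definition Jbar : 'M[R]_3 := mx3 [:: [:: 0; -1; 0]; [:: 1; 0; 0]; [:: 0; 0; 0]].

Definition rot (t : R) : 'M[R]_3 :=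
  mx3 [:: [:: cos t; - sin t; 0]; [:: sin t; cos t; 0]; [:: 0; 0; 1]].

Definition kappa : 'M[R]_3 := mx3 [:: [:: 1; 0; 0]; [:: 0; 1; 0]; [:: 0; 0; -1]].

(* Apply the 3 x 3 matrix [A] to the position of every body. *)
Definition on_bodies (N : nat) (A : 'M[R]_3) (x : 'M[R]_(N, 3)) := x *m A^T.

Definition enorm (v : 'rV[R]_3) : R := Num.sqrt (\sum_k v 0 k ^+ 2).

Definition collision (N : nat) (x : 'M[R]_(N, 3)) : Prop :=
  exists i j : 'I_N, i != j /\ row i x = row j x.

End three_dim.

Section symmetries.
Variables (R : realType) (N : nat).

(* The element (s_perm, s_rot, s_refl, s_shift) of S_N x SO(2) x Z_2 x S^1. *)
Record symmetry := Sym {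
  s_perm : {perm 'I_N}; s_rot : R; s_refl : bool; s_shift : R }.

(* (g x)_j (t) = kappa^refl e^{- rot J} x_{perm j} (t + shift) *)
Definition act (g : symmetry) (x : R -> 'M[R]_(N, 3)) (t : R) : 'M[R]_(N, 3) :=
  on_bodies (kappa R ^+ s_refl g *m rot (- s_rot g))
            (row_perm (s_perm g) (x (t + s_shift g))).

Definition has_symmetries (H : set symmetry) (x : R -> 'M[R]_(N, 3)) : Prop :=
  forall g, H g -> act g x = x.

Definition expi (t : R) : R[i] := (cos t +i* sin t)%C.

(* The loop w e^{it} + conj(w) e^{-it}, which is real valued. *)
Definition mode (w : 'M[R[i]]_(N, 3)) (t : R) : 'M[R]_(N, 3) :=
  \matrix_(j, k) complex.Re (w j k * expi t + (w j k)^* * expi (- t)).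

End symmetries.

Section n_plus_1_bodies.
Variables (R : realType) (n : nat) (mu : R).

Definition zeta : R := 2 * pi / n%:R.

Definition s_ (k : nat) : R :=
  4^-1 * \sum_(1 <= j < n) sin (k%:R * j%:R * zeta / 2) ^+ 2
                           / sin (j%:R * zeta / 2) ^+ 3.

Definition omega : R := mu + s_ 1.

(* The central body is omitted when mu = 0: the bodies are then 1, ..., n. *)
Definition nbodies : nat := ((mu != 0%R) + n)%N.

(* The number in 0, ..., n of the body stored in row [i]. *)
Definition label (i : 'I_nbodies) : nat := (i + (mu == 0%R))%N.

Definition mass (i : 'I_nbodies) : R := if label i == 0%N then mu else 1.

Definition massmx : 'M[R]_nbodies := diag_mx (\row_i mass i).

Notation config := 'M[R]_(nbodies, 3).

Definition potential (x : config) : R :=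
  omega / 2 * (\sum_j mass j * (x j 0 ^+ 2 + x j 1 ^+ 2))
  + \sum_(i < nbodies) \sum_(j < nbodies | (i < j)%N)
      mass i * mass j * (enorm (row j x - row i x))^-1.

Definition collision_free (x : R -> config) : Prop :=
  forall t, ~ collision (x t).

Definition newton (x : R -> config) (nu : R) (t : R) : Prop :=
  - nu ^+ 2 *: (massmx *m derive1n 2 x t)
  - (2 * Num.sqrt omega * nu) *: on_bodies (Jbar R) (massmx *m derive1 x t)
  + gradient potential (x t) = 0.

Definition is_solution (x : H2 R nbodies) (nu : R) : Prop :=
  [/\ 0 < nu,
      collision_free x,
      \forall t \ae (@lebesgue_measure R), newton x nu t
    & \int[@lebesgue_measure R]_(t in `[0, 2 * pi]) (\sum_j x t j 2) = 0].

(* The Hermitian matrix of the linearization on the first Fourier mode. *)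
Definition linearization (a : config) (nu : R) : 'M[R[i]]_(nbodies * 3) :=
  let toC := map_mx (real_complex R) in
  let massM := toC (diag_mx (mxvec (\matrix_(j, k) mass j : config))) in
  let calJ := toC (lin_mx (@on_bodies R nbodies (Jbar R)))^T in
  (real_complex R (nu ^+ 2)) *: massM
  - (real_complex R (2 * nu * Num.sqrt omega)) *: ((('i%C *: calJ)) *m massM)
  + toC (hessian potential a).

Definition mode_space (H : set (symmetry R nbodies)) :
    set 'rV[R[i]]_(nbodies * 3) :=
  [set w | has_symmetries H (mode (vec_mx w))].

Definition morse_number (H : set (symmetry R nbodies)) (a : config) (nu : R) :=
  n_neg_eigenvalues (restriction (mode_space H) (linearization a nu)).

Definition const_space (H : set (symmetry R nbodies)) (a : config) :
    set 'rV[R]_(nbodies * 3) :=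
  [set y | has_symmetries H (cst (vec_mx y)) /\
           \sum_j \sum_k vec_mx y j k * on_bodies (Jbar R) a j k = 0].

Definition orientation (H : set (symmetry R nbodies)) (a : config) : int :=
  sgz (\det (restriction (const_space H a) (hessian potential a))).

Definition local_degree (H : set (symmetry R nbodies)) (a : config) (nu : R)
    (d : int) : Prop :=
  \forall rho \near 0^'+,
    d = orientation H a * ((morse_number H a (nu - rho))%:Z
                           - (morse_number H a (nu + rho))%:Z).

Definition solutions (H : set (symmetry R nbodies)) : set (H2 R nbodies * R) :=
  [set p | is_solution p.1 p.2 /\ has_symmetries H p.1].

(* The trivial solutions are the relative equilibria, i.e. the constants. *)
Definition nontrivial_solutions (H : set (symmetry R nbodies)) :=
  solutions H `&` [set p | ~ exists a : config, loop p.1 = cst a].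

(* The connected component of (a, nu) in the solutions with symmetries H that
   are limits of nontrivial ones. *)
Definition branch (H : set (symmetry R nbodies)) (a : config) (nu : R) :
    set (H2 R nbodies * R) :=
  connected_component
    (solutions H `&` closure (nontrivial_solutions H)) (const_loop a, nu).

Definition bifurcates (H : set (symmetry R nbodies)) (a : config) (nu : R) :=
  forall theta, let p := (const_loop (on_bodies (rot theta) a), nu) in
    branch H a nu p /\
    closure (branch H a nu `&` nontrivial_solutions H) p.

Definition unbounded_norm_or_period (C : set (H2 R nbodies * R)) : Prop :=
  (forall M : R, exists2 p, C p & M < h2norm p.1) \/
  (forall M : R, exists2 p, C p & M < 2 * pi / p.2).

(* Some elements of [C] converge, uniformly in time, to a collision path. *)
Definition ends_in_collision (C : set (H2 R nbodies * R)) : Prop :=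
  exists y : R -> config,
    [/\ continuous y,
        forall t, y (t + 2 * pi) = y t,
        exists t, collision (y t)
      & forall e : R, 0 < e ->
          exists2 p, C p & forall t, `|loop p.1 t - y t| < e].

Definition nonadmissible (C : set (H2 R nbodies * R)) : Prop :=
  unbounded_norm_or_period C \/ ends_in_collision C.

(* [bs] lists the orbits of bifurcation points on [C], which are the constant
   elements of [C], with their frequencies and local degrees. *)
Definition admissible (H : set (symmetry R nbodies))
    (C : set (H2 R nbodies * R)) : Prop :=
  exists bs : seq (config * R * int),
    [/\ (2 <= size bs)%N,
        forall b, b \in bs ->
          C (const_loop b.1.1, b.1.2) /\ local_degree H b.1.1 b.1.2 b.2,
        forall (i j : nat) b0, (i < j < size bs)%N ->
          ~ exists theta,
            (nth b0 bs j).1 = (on_bodies (rot theta) (nth b0 bs i).1.1,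
                               (nth b0 bs i).1.2),
        forall (a : config) nu, C (const_loop a, nu) ->
          exists2 b, b \in bs &
            exists theta, (a, nu) = (on_bodies (rot theta) b.1.1, b.1.2)
      & \sum_(b <- bs) b.2 = 0].

Definition has_global_branch (H : set (symmetry R nbodies)) (a : config)
    (nu : R) : Prop :=
  bifurcates H a nu /\
  (nonadmissible (branch H a nu) \/ admissible H (branch H a nu)).

Definition polygon : config :=
  \matrix_(i, k) if label i == 0%N then 0
    else if k == 0 then cos ((label i)%:R * zeta)
    else if k == 1 then sin ((label i)%:R * zeta) else 0.

(* 0 |-> 0 and j |-> j + 1 modulo n on 1, ..., n. *)
Definition next_label (l : nat) : nat := if l == 0%N then 0%N else (l %% n).+1.

Local Lemma nbodiesD : (nbodies + (mu == 0%R) = n.+1)%N.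
Proof. by rewrite /nbodies; case: (mu == 0) => /=; rewrite ?addn1 ?addn0. Qed.

Local Lemma label_le i : (label i <= n)%N.
Proof. by rewrite -ltnS -nbodiesD ltn_add2r. Qed.

Local Lemma label_ge i : ((mu == 0%R) <= label i)%N.
Proof. exact: leq_addl. Qed.

Local Lemma next_label_ge l (b : bool) : (b <= l)%N -> (b <= next_label l)%N.
Proof. by rewrite /next_label; case: l b => [|l] []. Qed.

Local Lemma next_label_le l : (l <= n)%N -> (next_label l <= n)%N.
Proof.
rewrite /next_label; case: l => [//|l] ln /=.
by rewrite ltn_mod (leq_trans _ ln).
Qed.

Local Lemma next_label_lt i : (next_label (label i) - (mu == 0%R) < nbodies)%N.
Proof.
rewrite -(ltn_add2r (mu == 0%R)) subnK ?next_label_ge ?label_ge //.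
by rewrite nbodiesD ltnS next_label_le ?label_le.
Qed.

Local Lemma next_label_inj l k : (l <= n)%N -> (k <= n)%N ->
  next_label l = next_label k -> l = k.
Proof.
rewrite /next_label; case: l => [|l]; case: k => [|k] //= ln kn [].
have n0 : (0 < n)%N by exact: leq_trans ln.
case: (ltngtP l.+1 n) ln => // [ln|ln] _; case: (ltngtP k.+1 n) kn => // [kn|kn] _.
- by rewrite !modn_small.
- by rewrite kn modnn modn_small.
- by rewrite ln modnn modn_small.
- by rewrite ln kn.
Qed.

Definition next_body (i : 'I_nbodies) : 'I_nbodies := Ordinal (next_label_lt i).

Local Lemma next_body_inj : injective next_body.
Proof.
move=> i j /(congr1 val) /= e; apply: val_inj => /=.
suff : label i = label j by rewrite /label => /addIn.
apply: next_label_inj; rewrite ?label_le //.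
rewrite -(subnK (next_label_ge (label_ge i))) e subnK //.
exact/next_label_ge/label_ge.
Qed.

Definition shift : {perm 'I_nbodies} := perm next_body_inj.

(* Z_n(zeta, zeta, - n zeta) x Z_2(kappa): the elements
   (zeta, zeta, - n zeta)^k kappa^b. *)
Definition Zn_Z2 : set (symmetry R nbodies) :=
  [set g | exists (k : nat) (b : bool),
     g = Sym (shift ^+ k)%g (k%:R * zeta) b (- (k%:R * (n%:R * zeta)))].

Definition planar (x : config) (i : 'I_nbodies) : R[i] := (x i 0 +i* x i 1)%C.

End n_plus_1_bodies.

Arguments Zn_Z2 {R} n mu _.
Arguments polygon {R} n mu.

(* Main.v *)
Require Import Defs.
From HB Require Import structures.
From mathcomp Require Import all_boot all_order all_fingroup all_algebra.
From mathcomp Require Import complex.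
From mathcomp Require Import all_classical all_reals all_analysis.
From mathcomp Require Import ring lra.

Import Order.TTheory GRing.Theory Num.Theory.
Import numFieldNormedType.Exports.

Set Implicit Arguments.
Unset Strict Implicit.
Unset Printing Implicit Defensive.

Local Open Scope classical_set_scope.
Local Open Scope ring_scope.

(* For loops with the symmetries the equations of motion decouple: the bodies
   stay on a rotating homothetic polygon, and a homothetic polygon attracts its
   own vertices like a single mass [omega] at the centre ([s_1] is the share of
   the polygon itself, and [mu] that of the central body).  At [nu = sqrt omega]
   the problem is thus the Kepler problem in a rotating frame, all of whose
   ellipses of semi-major axis 1 have period [2 pi].  These ellipses form a path
   of solutions parametrized by the eccentricity [e] in [0, 1): it starts at the
   circular solution, which is the polygonal equilibrium, and as [e -> 1] it
   converges uniformly to a straight-line collision orbit.  The branch is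
   therefore non-admissible, and no degree is needed. *)

(** * The eccentric anomaly *)

Section trigonometry.
Context {R : realType}.
Implicit Types x y t : R.

(** Two topologies are in play. Membership in the branch is a matter of [H2]: a path in the
    parameters (e, th) must be continuous together with two time derivatives, which contain powers
    of 1/r. Near a fixed |e| < 1 the distance r to the focus stays away from 0, and that is enough.
    Ending in collision asks only for uniform convergence of the positions as e -> 1, where r does
    vanish. The obstacle there is Kepler's equation t = x - e sin x: at e = 1 its derivative in x
    vanishes at the collision, so the inverse function theorem gives no continuity of x up to e = 1.
    An explicit modulus of continuity, valid for all |e| <= 1 at once, does. The second parameter
    th, the orientation of the ellipse, is there because [bifurcates] speaks of every rotation of
    the polygon. The connected component may contain more than these ellipses, so the shape of its
    elements is read off from the symmetries alone. *)

Lemma lipschitz_of_derive_le1 (f df : R -> R) :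
  (forall x, is_derive x 1 f (df x)) -> (forall x, `|df x| <= 1) ->
  forall x y, `|f x - f y| <= `|x - y|.
Proof.
move=> fdf df1 x y; wlog xy : x y / y <= x.
  by move=> H; case: (leP y x) => [/H//|/ltW /H]; rewrite distrC (distrC x).
have fc : {within `[y, x], continuous f}.
  apply: continuous_subspaceT => z.
  exact/differentiable_continuous/derivable1_diffP.
have [c _ ->] := MVT_segment xy (fun z _ => fdf z) fc.
by rewrite normrM ler_piMl.
Qed.

Lemma ler_dist_sin x y : `|sin x - sin y| <= `|x - y|.
Proof.
exact: lipschitz_of_derive_le1 (fun z => is_derive_sin z) (@cos_max R) x y.
Qed.

Lemma ler_dist_cos x y : `|cos x - cos y| <= `|x - y|.
Proof.
apply: (@lipschitz_of_derive_le1 _ (fun z => - sin z)) => // z.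
by rewrite normrN sin_max.
Qed.

Lemma sin_lt_id x : 0 < x -> sin x < x.
Proof.
move=> x0; case: (ltP 1 x) => [|x1]; first exact/le_lt_trans/sin_le1.
have sc : {within `[0, x], continuous (@sin R)}.
  by apply: continuous_subspaceT => z; exact: continuous_sin.
have [c] := MVT x0 (fun z _ => is_derive_sin z) sc.
rewrite in_itv /= => /andP[c0 cx]; rewrite sin0 !subr0 => ->.
have sc0 : 0 < sin c by apply: sin2_gt0; apply/andP; split => //; lra.
have cc := cos2Dsin2 c; have := cos_le1 c.
have s2 : 0 < sin c ^+ 2 by rewrite exprn_gt0.
rewrite gtr_pMl // le_eqVlt => /orP[/eqP c1|//].
by move: cc; rewrite c1 expr1n; lra.
Qed.

Lemma sin_sub x y : sin x - sin y = 2 * sin ((x - y) / 2) * cos ((x + y) / 2).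
Proof.
have -> : sin x = sin ((x + y) / 2 + (x - y) / 2) by congr sin; field.
have -> : sin y = sin ((x + y) / 2 - (x - y) / 2) by congr sin; field.
by rewrite sinB sinD; ring.
Qed.

Lemma sqr_norm_cos_sin (a b t : R) :
  (cos t * a - sin t * b) ^+ 2 + (sin t * a + cos t * b) ^+ 2 = a ^+ 2 + b ^+ 2.
Proof.
have -> : (cos t * a - sin t * b) ^+ 2 + (sin t * a + cos t * b) ^+ 2 =
  (a ^+ 2 + b ^+ 2) * (cos t ^+ 2 + sin t ^+ 2) by ring.
by rewrite cos2Dsin2 mulr1.
Qed.

Lemma sin_add2pi t : sin (t + 2 * pi) = sin t.
Proof. by rewrite mulr_natl sinD2pi. Qed.

Lemma cos_add2pi t : cos (t + 2 * pi) = cos t.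
Proof. by rewrite mulr_natl cosD2pi. Qed.

End trigonometry.

(** * Kepler's equation and its solution, uniformly in the eccentricity *)

Section eccentric_anomaly.
Context {R : realType}.
Implicit Types e t x y d : R.

(* A lower bound, for all eccentricities [|e| <= 1] at once, of the increase of
   [x - e * sin x] on an interval of length [d]; at [e = 1] the derivative
   vanishes at the collision, and this replaces it. *)
Let gap d := d - 2 * `|sin (d / 2)|.

Let gap_gt0 d : 0 < d -> 0 < gap d.
Proof.
move=> d0; rewrite /gap.
have d2 : 0 < d / 2 by rewrite divr_gt0.
suff : `|sin (d / 2)| < d / 2 by lra.
rewrite ltr_norml sin_lt_id // andbT.
case: (ltP (d / 2) 1) => [h|]; last first.
  rewrite le_eqVlt => /orP[/eqP <-|].
    have : 0 < sin (1 : R) by apply: sin2_gt0; apply/andP; split; lra.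
    lra.
  have := sin_geN1 (d / 2); lra.
have : 0 < sin (d / 2) by apply: sin2_gt0; apply/andP; split; lra.
lra.
Qed.

Let gap_homo d d' : d <= d' -> gap d <= gap d'.
Proof.
move=> dd; rewrite /gap.
have := ler_dist_sin (d' / 2) (d / 2).
have := lerB_dist (sin (d' / 2)) (sin (d / 2)).
rewrite -mulrBl (@ger0_norm _ ((d' - d) / 2)) ?mulr_ge0 ?subr_ge0 ?invr_ge0 //.
lra.
Qed.

(** The sum-to-product formula bounds [e * (sin x - sin y)] by 2 |sin ((x - y) / 2)|, which is what
    [gap] subtracts; changing [e] into [e'] costs at most |e - e'|. *)
Let gap_le e e' x y : `|e| <= 1 ->
  gap `|x - y| <= `|(x - e * sin x) - (y - e' * sin y)| + `|e - e'|.
Proof.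
move=> e1; rewrite /gap.
have -> : (x - e * sin x) - (y - e' * sin y) =
  (x - y) - (e * (sin x - sin y) + (e - e') * sin y) by ring.
have h1 := lerB_dist (x - y) (e * (sin x - sin y) + (e - e') * sin y).
have h2 := ler_normD (e * (sin x - sin y)) ((e - e') * sin y).
have h3 : `|(e - e') * sin y| <= `|e - e'| by rewrite normrM ler_piMr ?sin_max.
have h4 : `|e * (sin x - sin y)| <= 2 * `|sin (`|x - y| / 2)|.
  rewrite normrM (le_trans (ler_piMl _ e1)) // sin_sub !normrM ger0_norm //.
  apply: le_trans (ler_piMr _ (cos_max _)) _; first by rewrite mulr_ge0.
  case: (ler0P (x - y)) => // _.
  by rewrite mulNr sinN normrN.
lra.
Qed.

(** The root of Kepler's equation at mean anomaly [t]. It has no closed form, hence the choice; for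
    |e| <= 1 it exists and is unique. *)
Definition anomaly e t : R := xget 0 [set x | x - e * sin x = t].

Lemma anomalyP e t : `|e| <= 1 -> anomaly e t - e * sin (anomaly e t) = t.
Proof.
move=> e1; rewrite /anomaly; case: xgetP => [x ->//|/(_ _) no].
(* As |e sin x| <= 1, a root lies within distance 1 of [t]. *)
have fc : {within `[t - 1, t + 1], continuous (fun x => x - e * sin x)}.
  apply: continuous_subspaceT => x; apply: cvgB; first exact: cvg_id.
  by apply: cvgM; [exact: cvg_cst|exact: continuous_sin].
have es x : `|e * sin x| <= 1 by rewrite normrM mulr_ile1 ?sin_max.
have tt : t - 1 <= t + 1 by lra.
have [|c _ /= ct] := IVT (v := t) tt fc; last by case: (no c).
have := es (t - 1); have := es (t + 1).
rewrite !ler_norml => /andP[a b] /andP[c d].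
by rewrite ge_min le_max; apply/andP; split; apply/orP; [left|right]; lra.
Qed.

(** The modulus is [gap eps]: anomalies at least [eps] apart force the data to be at least [gap eps]
    apart. It does not depend on [e], so it covers the collision case e = 1. *)
Lemma anomaly_unif_continuous (eps : R) : 0 < eps -> exists2 d : R, 0 < d &
  forall e e' t t', `|e| <= 1 -> `|e'| <= 1 -> `|t - t'| + `|e - e'| < d ->
  `|anomaly e t - anomaly e' t'| < eps.
Proof.
move=> eps0; exists (gap eps); first exact: gap_gt0.
move=> e e' t t' e1 e1'; rewrite ltNge => H; rewrite ltNge; apply: contra H.
move/gap_homo/le_trans; apply; apply: le_trans (gap_le e' _ _ e1) _.
by rewrite !anomalyP.
Qed.

Lemma anomaly_uniq e x y : `|e| <= 1 -> x - e * sin x = y - e * sin y -> x = y.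
Proof.
move=> e1 xy; apply/eqP; rewrite -subr_eq0 -normr_le0 leNgt; apply/negP.
move=> /gap_gt0; rewrite ltNge => /negP; apply.
by apply: le_trans (gap_le e x y e1) _; rewrite xy !subrr normr0 addr0.
Qed.

Lemma anomalyK e x : `|e| <= 1 -> anomaly e (x - e * sin x) = x.
Proof. by move=> e1; apply: (@anomaly_uniq e); rewrite ?anomalyP. Qed.

Lemma anomalyD2pi e t : `|e| <= 1 -> anomaly e (t + 2 * pi) = anomaly e t + 2 * pi.
Proof.
move=> e1; apply: (@anomaly_uniq e); rewrite ?anomalyP //.
by rewrite sin_add2pi addrAC anomalyP.
Qed.

Lemma anomaly0 t : anomaly 0 t = t.
Proof. by have := anomalyP t (e := 0); rewrite mul0r subr0 normr0 => ->. Qed.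

Lemma is_derive_anomaly e t : `|e| < 1 ->
  is_derive t 1 (anomaly e) (1 - e * cos (anomaly e t))^-1.
Proof.
move=> e1; have e1' := ltW e1; set x := anomaly e t.
have der (z : R) : is_derive z 1 (fun x => x - e * sin x) (1 - e * cos z).
  have ds := is_derive_sin z.
  have dm : is_derive z 1 (fun x => e * sin x) (e * cos z) by exact: is_deriveZ.
  exact: is_deriveB.
(* The derivative of an inverse is taken at a value of the direct function, so the base point [t] is
   written as Kepler's expression in [x]. *)
rewrite -[t in is_derive t _ _ _](anomalyP t e1').
apply: (@is_derive_inverse R (fun x => x - e * sin x)).
- by near=> z; exact: anomalyK.
- near=> z; exact/differentiable_continuous/derivable1_diffP.
- rewrite subr_eq0 eq_sym; apply/eqP => ec.
  have : `|e * cos x| < 1.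
    by rewrite normrM (le_lt_trans _ e1) // ler_piMr ?cos_max.
  by rewrite ec normr1 ltxx.
Unshelve. all: by end_near. Qed.

Lemma continuous_anomaly e : `|e| <= 1 -> continuous (anomaly e).
Proof.
move=> e1 t; apply/cvgrPdist_lt => eps /anomaly_unif_continuous[d d0 H].
near=> s; apply: H => //; rewrite subrr normr0 addr0.
by near: s; apply: cvgr_dist_lt.
Unshelve. all: by end_near. Qed.

End eccentric_anomaly.

(** * Kepler ellipses and their dependence on the eccentricity *)

Section uniform_convergence.
Context {R : realType} {T : Type} (F : set_system T) {FF : Filter F}.
Implicit Types (f : T -> R -> R) (g : R -> R) (c : T -> R).

(** The filter is arbitrary so that the same calculus serves e -> 0+, e -> 1- and continuity at a
    point; uniformity is in the time [t]. *)
Definition unif_cvg f g :=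
  forall eps, 0 < eps -> \forall s \near F, forall t, `|f s t - g t| < eps.

(* Boundedness of the limit makes the notion stable under products. *)
Definition bounded_unif_cvg f g :=
  unif_cvg f g /\ exists M, forall t, `|g t| <= M.

Lemma bounded_unif_cvg_cst c (c0 : R) : c s @[s --> F] --> c0 ->
  bounded_unif_cvg (fun s _ => c s) (fun _ => c0).
Proof.
move=> cc; split; last by exists `|c0|.
move=> eps eps0; near=> s => _; rewrite distrC.
by near: s; exact: cvgr_dist_lt.
Unshelve. all: by end_near. Qed.

(** The passage from unbounded limits to bounded ones: the angles [anomaly e t] and [th - t] are
    unbounded in [t], their sines and cosines are not. *)
Lemma bounded_unif_cvg_lipschitz (h : R -> R) f g :
  (forall x y, `|h x - h y| <= `|x - y|) -> (forall x, `|h x| <= 1) ->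
  unif_cvg f g -> bounded_unif_cvg (fun s t => h (f s t)) (fun t => h (g t)).
Proof.
move=> lh h1 fg; split; last by exists 1.
move=> eps eps0; near=> s => t; apply: le_lt_trans (lh _ _) _.
by move: t; near: s; exact: fg.
Unshelve. all: by end_near. Qed.

Lemma bounded_unif_cvgD f1 g1 f2 g2 :
  bounded_unif_cvg f1 g1 -> bounded_unif_cvg f2 g2 ->
  bounded_unif_cvg (fun s t => f1 s t + f2 s t) (fun t => g1 t + g2 t).
Proof.
move=> [c1 [M1 b1]] [c2 [M2 b2]]; split; last first.
  by exists (M1 + M2) => t; apply: le_trans (ler_normD _ _) (lerD _ _).
move=> eps eps0; have e2 : 0 < eps / 2 by rewrite divr_gt0.
near=> s => t; rewrite (splitr eps).
have -> : f1 s t + f2 s t - (g1 t + g2 t) = (f1 s t - g1 t) + (f2 s t - g2 t).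
  by ring.
apply: le_lt_trans (ler_normD _ _) (ltrD _ _).
  by move: t; near: s; exact: c1.
by move: t; near: s; exact: c2.
Unshelve. all: by end_near. Qed.

Lemma bounded_unif_cvgM f1 g1 f2 g2 :
  bounded_unif_cvg f1 g1 -> bounded_unif_cvg f2 g2 ->
  bounded_unif_cvg (fun s t => f1 s t * f2 s t) (fun t => g1 t * g2 t).
Proof.
move=> [c1 [M1 b1]] [c2 [M2 b2]].
have M10 : 0 <= M1 by apply: le_trans (b1 0).
have M20 : 0 <= M2 by apply: le_trans (b2 0).
split; last first.
  by exists (M1 * M2) => t; rewrite normrM ler_pM.
move=> eps eps0.
(* The error is at most d^2 + d M2 + M1 d. The [eps] in the denominator makes d < 1, so that d^2 <=
   d, and leaves room for a strict inequality. *)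
pose d := eps / (M1 + M2 + 1 + eps).
have D0 : 0 < M1 + M2 + 1 + eps by lra.
have d0 : 0 < d by rewrite divr_gt0.
have d1 : d < 1 by rewrite ltr_pdivrMr // mul1r; lra.
near=> s => t.
have h1 : `|f1 s t - g1 t| < d by move: (t); near: s; exact: c1.
have h2 : `|f2 s t - g2 t| < d by move: (t); near: s; exact: c2.
have -> : f1 s t * f2 s t - g1 t * g2 t =
  (f1 s t - g1 t) * (f2 s t - g2 t) + (f1 s t - g1 t) * g2 t
  + g1 t * (f2 s t - g2 t) by ring.
have n1 := ler_normD ((f1 s t - g1 t) * (f2 s t - g2 t) + (f1 s t - g1 t) * g2 t)
   (g1 t * (f2 s t - g2 t)).
have n2 := ler_normD ((f1 s t - g1 t) * (f2 s t - g2 t)) ((f1 s t - g1 t) * g2 t).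
have n3 : `|(f1 s t - g1 t) * (f2 s t - g2 t)| <= d * 1.
  by rewrite normrM ler_pM // ltW // (lt_trans h2).
have n4 : `|(f1 s t - g1 t) * g2 t| <= d * M2 by rewrite normrM ler_pM // ltW.
have n5 : `|g1 t * (f2 s t - g2 t)| <= M1 * d by rewrite normrM ler_pM // ltW.
have n6 : d * (M1 + M2 + 1 + eps) = eps by rewrite /d divfK // gt_eqF.
have n7 : 0 < d * eps by rewrite mulr_gt0.
lra.
Unshelve. all: by end_near. Qed.

Lemma bounded_unif_cvgN f g :
  bounded_unif_cvg f g -> bounded_unif_cvg (fun s t => - f s t) (fun t => - g t).
Proof.
move=> [c [M b]]; split; last by exists M => t; rewrite normrN.
move=> eps eps0; near=> s => t; rewrite -opprD normrN.
by move: t; near: s; exact: c.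
Unshelve. all: by end_near. Qed.

Lemma bounded_unif_cvgB f1 g1 f2 g2 :
  bounded_unif_cvg f1 g1 -> bounded_unif_cvg f2 g2 ->
  bounded_unif_cvg (fun s t => f1 s t - f2 s t) (fun t => g1 t - g2 t).
Proof. by move=> h1 h2; apply: bounded_unif_cvgD (bounded_unif_cvgN h2). Qed.

Lemma bounded_unif_cvgV f g (m : R) : 0 < m -> (forall t, m <= g t) ->
  bounded_unif_cvg f g ->
  bounded_unif_cvg (fun s t => (f s t)^-1) (fun t => (g t)^-1).
Proof.
move=> m0 mg [c _]; split; last first.
  exists m^-1 => t; have gt0 := lt_le_trans m0 (mg t).
  by rewrite gtr0_norm ?invr_gt0 // lef_pV2.
(* The first bound keeps [f] above m / 2; the second absorbs the denominator f g >= m (m / 2) of the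
   difference of the inverses. *)
move=> eps eps0; pose d := Num.min (m / 2) (eps * (m * (m / 2))).
have d0 : 0 < d by rewrite lt_min !(divr_gt0, mulr_gt0).
near=> s => t.
have h : `|f s t - g t| < d by move: (t); near: s; exact: c.
have hm : `|f s t - g t| < m / 2 by rewrite (lt_le_trans h) // ge_min lexx.
have gt := mg t; have g0 := lt_le_trans m0 gt.
have f2 : m / 2 < f s t by move: hm; rewrite ltr_distl => /andP[]; lra.
have f0 : 0 < f s t by rewrite (lt_trans _ f2) // divr_gt0.
have -> : (f s t)^-1 - (g t)^-1 = (g t - f s t) / (g t * f s t).
  by field; rewrite !gt_eqF.
rewrite normrM distrC gtr0_norm ?invr_gt0 ?mulr_gt0 //.
rewrite ltr_pdivrMr ?mulr_gt0 //; apply: lt_le_trans h _.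
rewrite ge_min; apply/orP; right.
by rewrite ler_pM2l // ler_pM // ?divr_ge0 ?ltW.
Unshelve. all: by end_near. Qed.

End uniform_convergence.

(** * Motion on a Kepler ellipse *)

Section kepler_ellipse.
Context {R : realType}.
Implicit Types e th t p q : R.

(* The ellipse has semi-major axis 1 and one focus at 0; [focal_radius] is the
   distance to that focus. *)
Definition ell_x e t := cos (anomaly e t) - e.
Definition ell_y e t := Num.sqrt (1 - e ^+ 2) * sin (anomaly e t).
Definition focal_radius e t := 1 - e * cos (anomaly e t).
Definition vel_x e t := - (sin (anomaly e t) * (focal_radius e t)^-1).
Definition vel_y e t := Num.sqrt (1 - e ^+ 2) * cos (anomaly e t) * (focal_radius e t)^-1.

(** Together with [spin_y], multiplication of p + iq by e^{i th}. At the angle [th - t] it turns the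
    ellipse by [th] and passes to the frame rotating at unit speed in normalized time. *)
Definition spin_x th p q := cos th * p - sin th * q.
Definition spin_y th p q := sin th * p + cos th * q.

(** In complex form, with z = p + iq, the derivative of e^{i(th - t)} z is e^{i(th - t)} (z' - iz),
    and -iz = q - ip. *)
Lemma is_derive_spin_x th t (p q : R -> R) dp dq :
  is_derive t 1 p dp -> is_derive t 1 q dq ->
  is_derive t 1 (fun s => spin_x (th - s) (p s) (q s))
    (spin_x (th - t) (dp + q t) (dq - p t)).
Proof.
move=> hp hq.
have ha : is_derive t 1 (fun s => th - s) (- 1).
  by apply: (is_derive_eq (is_deriveB (f := cst th) _ _)); rewrite sub0r.
have hc : is_derive t 1 (fun s => cos (th - s)) (sin (th - t)).
  by apply: (is_derive_eq (is_derive1_comp (f := cos) (is_derive_cos _) ha)); ring.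
have hs : is_derive t 1 (fun s => sin (th - s)) (- cos (th - t)).
  by apply: (is_derive_eq (is_derive1_comp (f := sin) (is_derive_sin _) ha)); ring.
apply: (is_derive_eq (is_deriveB (is_deriveM hc hp) (is_deriveM hs hq))).
by rewrite /spin_x /GRing.scale /=; ring.
Qed.

Lemma is_derive_spin_y th t (p q : R -> R) dp dq :
  is_derive t 1 p dp -> is_derive t 1 q dq ->
  is_derive t 1 (fun s => spin_y (th - s) (p s) (q s))
    (spin_y (th - t) (dp + q t) (dq - p t)).
Proof.
(* The imaginary part of a number is the real part of its product with -i, a turn by -pi/2. *)
have spin_yx a u v : spin_y a u v = spin_x (a - pi / 2) u v.
  by rewrite /spin_y /spin_x cosBpihalf sinBpihalf mulNr opprK.
move=> hp hq; have := is_derive_spin_x (th - pi / 2) hp hq.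
rewrite spin_yx [_ - t]addrAC; congr (is_derive _ _ _ _).
by apply/funext => s; rewrite spin_yx addrAC.
Qed.

Lemma continuous_spin_x th (p q : R -> R) : continuous p -> continuous q ->
  continuous (fun t => spin_x (th - t) (p t) (q t)).
Proof.
move=> cp cq t.
have ct : th - s @[s --> t] --> th - t by apply: cvgB; [exact: cvg_cst|exact: cvg_id].
have cc := cvg_comp _ _ ct (@continuous_cos R (th - t)).
have cs := cvg_comp _ _ ct (@continuous_sin R (th - t)).
by apply: cvgB; apply: cvgM; [exact: cc|exact: cp|exact: cs|exact: cq].
Qed.

Lemma continuous_spin_y th (p q : R -> R) : continuous p -> continuous q ->
  continuous (fun t => spin_y (th - t) (p t) (q t)).
Proof.
move=> cp cq t.
have ct : th - s @[s --> t] --> th - t by apply: cvgB; [exact: cvg_cst|exact: cvg_id].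
have cc := cvg_comp _ _ ct (@continuous_cos R (th - t)).
have cs := cvg_comp _ _ ct (@continuous_sin R (th - t)).
by apply: cvgD; apply: cvgM; [exact: cs|exact: cp|exact: cc|exact: cq].
Qed.

Lemma focal_radius_ge e t : `|e| <= 1 -> 1 - `|e| <= focal_radius e t.
Proof.
move=> e1; rewrite /focal_radius lerD2l lerNr opprK.
apply: le_trans (ler_norm _) _.
by rewrite normrM ler_piMr // cos_max.
Qed.

Lemma focal_radius_gt0 e t : `|e| < 1 -> 0 < focal_radius e t.
Proof. by move=> e1; apply: lt_le_trans (focal_radius_ge _ (ltW e1)); rewrite subr_gt0. Qed.

Lemma sqr_sqrt1 e : `|e| <= 1 -> Num.sqrt (1 - e ^+ 2) ^+ 2 = 1 - e ^+ 2.
Proof.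
by move=> e1; rewrite sqr_sqrtr // subr_ge0 -real_normK ?num_real // expr_le1.
Qed.

Lemma sqr_focal_radius e t : `|e| <= 1 -> ell_x e t ^+ 2 + ell_y e t ^+ 2 = focal_radius e t ^+ 2.
Proof.
move=> e1; rewrite /ell_x /ell_y /focal_radius exprMn sqr_sqrt1 // sin2cos2; ring.
Qed.

Lemma is_derive_ell_x e t : `|e| < 1 -> is_derive t 1 (ell_x e) (vel_x e t).
Proof.
move=> e1; have hE := is_derive_anomaly t e1.
have hc := is_derive1_comp (f := cos) (is_derive_cos _) hE.
apply: (is_derive_eq (is_deriveB (g := cst e) hc _)).
by rewrite /vel_x subr0 mulNr.
Qed.

Lemma is_derive_ell_y e t : `|e| < 1 -> is_derive t 1 (ell_y e) (vel_y e t).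
Proof.
move=> e1; have hE := is_derive_anomaly t e1.
have hs := is_derive1_comp (f := sin) (is_derive_sin _) hE.
apply: (is_derive_eq (is_deriveZ (Num.sqrt (1 - e ^+ 2)) hs)).
by rewrite /vel_y -mulrA.
Qed.

Lemma is_derive_focal_radiusV e t : `|e| < 1 ->
  is_derive t 1 (fun t => (focal_radius e t)^-1)
    (- (e * sin (anomaly e t)) * (focal_radius e t)^-1 ^+ 3).
Proof.
move=> e1; have hE := is_derive_anomaly t e1.
have r0 : focal_radius e t != 0 by rewrite gt_eqF // focal_radius_gt0.
have hc := is_derive1_comp (f := cos) (is_derive_cos _) hE.
have hr : is_derive t 1 (focal_radius e) (e * sin (anomaly e t) * (focal_radius e t)^-1).
  have hm := is_deriveZ e hc.
  apply: (is_derive_eq (is_deriveB (is_derive_cst (1 : R) t 1) hm)).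
  by rewrite /GRing.scale /= /focal_radius; ring.
apply: (is_derive_eq (is_deriveV r0 hr)).
by rewrite /GRing.scale /=; field.
Qed.

(** With [is_derive_vel_y], this is the Kepler equation z'' = - z / r^3 with unit attraction. *)
Lemma is_derive_vel_x e t : `|e| < 1 ->
  is_derive t 1 (vel_x e) (- (ell_x e t * (focal_radius e t)^-1 ^+ 3)).
Proof.
move=> e1; have hE := is_derive_anomaly t e1.
have r0 : focal_radius e t != 0 by rewrite gt_eqF // focal_radius_gt0.
have hs := is_derive1_comp (f := sin) (is_derive_sin _) hE.
apply: (is_derive_eq (is_deriveN (is_deriveM hs (is_derive_focal_radiusV t e1)))).
rewrite /GRing.scale /= -/(focal_radius e t) /ell_x.
(* The square of the sine is eliminated, so that the rest is an identity of rational functions of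
   the cosine. *)
have -> : sin (anomaly e t) * (- (e * sin (anomaly e t)) * (focal_radius e t)^-1 ^+ 3) =
  - e * (1 - cos (anomaly e t) ^+ 2) * (focal_radius e t)^-1 ^+ 3.
  by rewrite -sin2cos2; ring.
move: r0; rewrite /focal_radius => r0; field.
by [].
Qed.

Lemma is_derive_vel_y e t : `|e| < 1 ->
  is_derive t 1 (vel_y e) (- (ell_y e t * (focal_radius e t)^-1 ^+ 3)).
Proof.
move=> e1; have hE := is_derive_anomaly t e1.
have r0 : focal_radius e t != 0 by rewrite gt_eqF // focal_radius_gt0.
have hc := is_derive1_comp (f := cos) (is_derive_cos _) hE.
apply: (is_derive_eq (is_deriveM (is_deriveZ (Num.sqrt (1 - e ^+ 2)) hc)
   (is_derive_focal_radiusV t e1))).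
rewrite /GRing.scale /= -/(focal_radius e t) /ell_y.
by move: r0; rewrite /focal_radius /GRing.scale /= => r0; field.
Qed.

Lemma ell_xD2pi e t : `|e| <= 1 -> ell_x e (t + 2 * pi) = ell_x e t.
Proof. by move=> e1; rewrite /ell_x anomalyD2pi // cos_add2pi. Qed.

Lemma ell_yD2pi e t : `|e| <= 1 -> ell_y e (t + 2 * pi) = ell_y e t.
Proof. by move=> e1; rewrite /ell_y anomalyD2pi // sin_add2pi. Qed.

(** * Dependence on the eccentricity: positions up to e = 1, velocities for |e| < 1 *)

Section continuity.
Context {T : Type} (F : set_system T) {FF : Filter F}.
Context (e th : T -> R) (e0 th0 : R).
Hypotheses (ee : e s @[s --> F] --> e0) (tth : th s @[s --> F] --> th0).
Hypotheses (e1 : \forall s \near F, `|e s| <= 1) (e01 : `|e0| <= 1).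

Local Notation "f ~~> g" := (bounded_unif_cvg F f g) (at level 70).

Let anomaly_cvg : unif_cvg F (fun s => anomaly (e s)) (anomaly e0).
Proof.
move=> eps /anomaly_unif_continuous[d d0 H]; near=> s => t; apply: H => //.
  by near: s; exact: e1.
rewrite subrr normr0 add0r distrC.
by near: s; apply: cvgr_dist_lt.
Unshelve. all: by end_near. Qed.

Let cosE_cvg : (fun s t => cos (anomaly (e s) t)) ~~> (fun t => cos (anomaly e0 t)).
Proof. exact: (bounded_unif_cvg_lipschitz (@ler_dist_cos R) (@cos_max R) anomaly_cvg). Qed.

Let sinE_cvg : (fun s t => sin (anomaly (e s) t)) ~~> (fun t => sin (anomaly e0 t)).
Proof. exact: (bounded_unif_cvg_lipschitz (@ler_dist_sin R) (@sin_max R) anomaly_cvg). Qed.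

Let e_cvg : (fun s _ => e s) ~~> (fun _ => e0).
Proof. exact: bounded_unif_cvg_cst. Qed.

Let sqrt_cvg : (fun s _ => Num.sqrt (1 - e s ^+ 2)) ~~> (fun _ => Num.sqrt (1 - e0 ^+ 2)).
Proof.
have h : 1 - e s ^+ 2 @[s --> F] --> 1 - e0 ^+ 2.
  by apply: cvgB; [exact: cvg_cst|exact: cvgM].
apply: bounded_unif_cvg_cst; apply: (@cvg_comp _ _ _ _ (@Num.sqrt R) _ _ _ h).
exact: sqrt_continuous.
Qed.

Lemma ell_x_cvg : (fun s => ell_x (e s)) ~~> ell_x e0.
Proof. exact: bounded_unif_cvgB. Qed.

Lemma ell_y_cvg : (fun s => ell_y (e s)) ~~> ell_y e0.
Proof. exact: bounded_unif_cvgM. Qed.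

Let rot_cvg : unif_cvg F (fun s t => th s - t) (fun t => th0 - t).
Proof.
move=> eps eps0; near=> s => t.
have -> : th s - t - (th0 - t) = th s - th0 by ring.
by rewrite distrC; near: s; apply: cvgr_dist_lt.
Unshelve. all: by end_near. Qed.

Lemma spin_x_cvg (p q : T -> R -> R) (p0 q0 : R -> R) : p ~~> p0 -> q ~~> q0 ->
  (fun s t => spin_x (th s - t) (p s t) (q s t)) ~~>
  (fun t => spin_x (th0 - t) (p0 t) (q0 t)).
Proof.
move=> hp hq; apply: bounded_unif_cvgB; apply: bounded_unif_cvgM => //.
  exact: (bounded_unif_cvg_lipschitz (@ler_dist_cos R) (@cos_max R) rot_cvg).
exact: (bounded_unif_cvg_lipschitz (@ler_dist_sin R) (@sin_max R) rot_cvg).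
Qed.

Lemma spin_y_cvg (p q : T -> R -> R) (p0 q0 : R -> R) : p ~~> p0 -> q ~~> q0 ->
  (fun s t => spin_y (th s - t) (p s t) (q s t)) ~~>
  (fun t => spin_y (th0 - t) (p0 t) (q0 t)).
Proof.
move=> hp hq; apply: bounded_unif_cvgD; apply: bounded_unif_cvgM => //.
  exact: (bounded_unif_cvg_lipschitz (@ler_dist_sin R) (@sin_max R) rot_cvg).
exact: (bounded_unif_cvg_lipschitz (@ler_dist_cos R) (@cos_max R) rot_cvg).
Qed.

Hypothesis e01' : `|e0| < 1.

(** The lower bound 1 - |e0| on the radius degenerates at e0 = 1, where the orbit reaches the focus;
    hence the strict hypothesis for velocities. *)
Lemma focal_radiusV_cvg :
  (fun s t => (focal_radius (e s) t)^-1) ~~> (fun t => (focal_radius e0 t)^-1).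
Proof.
apply: (@bounded_unif_cvgV _ _ _ _ _ _ (1 - `|e0|)); first by rewrite subr_gt0.
  by move=> t; exact: focal_radius_ge.
apply: bounded_unif_cvgB; last exact: bounded_unif_cvgM.
by apply: bounded_unif_cvg_cst; exact: cvg_cst.
Qed.

Lemma vel_x_cvg : (fun s => vel_x (e s)) ~~> vel_x e0.
Proof. by apply: bounded_unif_cvgN; apply: bounded_unif_cvgM => //; exact: focal_radiusV_cvg. Qed.

Lemma vel_y_cvg : (fun s => vel_y (e s)) ~~> vel_y e0.
Proof.
apply: bounded_unif_cvgM; last exact: focal_radiusV_cvg.
exact: bounded_unif_cvgM.
Qed.

End continuity.
End kepler_ellipse.

(** * Convergence of loops *)

Section H2_loops.
Context {R : realType} {N : nat}.
Notation mu := (@lebesgue_measure R).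
Implicit Types (A B : 'M[R]_(N, 3)) (x : R -> 'M[R]_(N, 3)).

Lemma is_derive_scale_mx (a : R -> R) A (t da : R) :
  is_derive t 1 a da -> is_derive t 1 (fun s => a s *: A) (da *: A).
Proof.
move=> ha.
have h i j : is_derive t 1 (fun s => (a s *: A) i j) (da * A i j).
  have -> : (fun s => (a s *: A) i j) = (fun s => A i j *: a s).
    by apply/funext => s; rewrite mxE mulrC.
  by apply: (is_derive_eq (is_deriveZ (A i j) ha)); rewrite /GRing.scale /= mulrC.
have d : derivable (fun s => a s *: A) t 1.
  by apply/derivable_mxP => i j; exact: (@ex_derive _ _ _ _ _ _ _ (h i j)).
apply: DeriveDef => //; rewrite derive_mx //; apply/matrixP => i j.
by rewrite !mxE; exact: (@derive_val _ _ _ _ _ _ _ (h i j)).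
Qed.

Lemma derive1_val x x' : (forall t : R, is_derive t 1 x (x' t)) -> derive1 x = x'.
Proof. by move=> dx; apply/funext => t; rewrite derive1E derive_val. Qed.

Lemma derive1n2_val x x' x'' : (forall t : R, is_derive t 1 x (x' t)) ->
  (forall t : R, is_derive t 1 x' (x'' t)) -> derive1n 2 x = x''.
Proof.
move=> dx dx'; rewrite derive1nS derive1n1 (derive1_val dx); exact: derive1_val.
Qed.

Lemma C2_isH2 x x' x'' : (forall t, x (t + 2 * pi) = x t) ->
  (forall t : R, is_derive t 1 x (x' t)) -> (forall t : R, is_derive t 1 x' (x'' t)) ->
  continuous x'' -> isH2 x.
Proof.
move=> px dx dx' cx''.
have e1 := derive1_val dx; have e2 := derive1n2_val dx dx'.
have cx' : continuous x'.
  by move=> t; apply/differentiable_continuous/derivable1_diffP.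
split=> //.
- by rewrite e1.
- by rewrite e2; exact: Defs.sqint_continuous.
rewrite e1 e2 => t /andP[t0 _] j k.
have co (f : R -> 'M[R]_(N, 3)) : continuous f -> continuous (fun s => f s j k : R).
  move=> cf s; apply: (@continuous_comp _ _ _ f (fun M : 'M[R]_(N, 3) => M j k)).
    exact: cf.
  exact: coord_continuous.
have d (s : R) : derivable (fun s => x' s j k) s 1.
  by have [/derivable_mxP /(_ j k)] := dx' s.
(* The fundamental theorem of calculus is applied on a nondegenerate interval, so t = 0 is
   separate. *)
move: t0; rewrite le_eqVlt => /orP[/eqP <-|t0].
  by rewrite set_itv1 Rintegral_set1 addr0.
rewrite /Rintegral (@continuous_FTC2 _ _ (fun s => x' s j k)) //=.
- by rewrite addrCA subrr addr0.
- by apply: continuous_subspaceT; exact: co.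
- split=> //.
  + by apply: cvg_at_right_filter; exact: co.
  + by apply: cvg_at_left_filter; exact: co.
- move=> s _; rewrite derive1E.
  have := @derive_mx _ _ _ _ x' s 1 (@ex_derive _ _ _ _ _ _ _ (dx' s)).
  by rewrite derive_val => ->; rewrite mxE.
Qed.

Lemma sqnormZ (a : R) A : sqnorm (a *: A) = a ^+ 2 * sqnorm A.
Proof.
rewrite /sqnorm mulr_sumr; apply: eq_bigr => j _; rewrite mulr_sumr.
by apply: eq_bigr => k _; rewrite mxE exprMn.
Qed.

Lemma h2dist_le (x y : H2 R N) (K : R) :
  (forall t, sqnorm (x t - y t) + sqnorm (derive1 x t - derive1 y t)
     + sqnorm (derive1n 2 x t - derive1n 2 y t) <= K) ->
  h2dist x y <= Num.sqrt (K * (2 * pi)).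
Proof.
move=> H; apply: ler_wsqrtr.
have -> : K * (2 * pi) = \int[mu]_(t in `[0, 2 * pi]) K.
  rewrite Rintegral_cst //= lebesgue_measure_itv /= lte_fin mulr_gt0 ?pi_gt0 //=.
  by rewrite subr0.
apply: le_Rintegral => //; first exact: Defs.dens_integrable.
apply: continuous_compact_integrable; first exact: segment_compact.
by apply: continuous_subspaceT => t; exact: cvg_cst.
Qed.

Definition has_derivatives (x : H2 R N) (f f' f'' : R -> 'M[R]_(N, 3)) : Prop :=
  [/\ loop x = f, derive1 (loop x) = f' & derive1n 2 (loop x) = f''].

Lemma h2_cvg {T : Type} (F : set_system T) {FF : Filter F}
    (X : T -> H2 R N) (x : H2 R N) (f f' f'' : T -> R -> 'M[R]_(N, 3))
    (g g' g'' : R -> 'M[R]_(N, 3)) :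
  (\forall s \near F, has_derivatives (X s) (f s) (f' s) (f'' s)) ->
  has_derivatives x g g' g'' ->
  (forall eps, 0 < eps -> \forall s \near F, forall t, sqnorm (g t - f s t) < eps) ->
  (forall eps, 0 < eps -> \forall s \near F, forall t, sqnorm (g' t - f' s t) < eps) ->
  (forall eps, 0 < eps -> \forall s \near F, forall t, sqnorm (g'' t - f'' s t) < eps) ->
  X s @[s --> F] --> x.
Proof.
move=> HX [xg xg' xg''] H H' H''; apply/cvg_ballP => eps eps0.
have sum3 (u v w d : R) : u < d -> v < d -> w < d -> u + v + w <= d * 3 by lra.
(* Three densities below [d], integrated over a period, give 3 d (2 pi) = (eps / 2)^2. The half
   turns the large inequality of [h2dist_le] into a strict one. *)
pose d := (eps / 2) ^+ 2 / (2 * pi) / 3.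
have d0 : 0 < d by rewrite /d !divr_gt0 ?exprn_gt0 ?mulr_gt0 ?divr_gt0 ?pi_gt0.
near=> s; apply: (@le_lt_trans _ _ (eps / 2)); last first.
  by rewrite ltr_pdivrMr // ltr_pMr // ltr1n.
have -> : eps / 2 = Num.sqrt (d * 3 * (2 * pi)).
  by rewrite /d !divfK ?sqrtr_sqr ?gtr0_norm ?divr_gt0 // gt_eqF // mulr_gt0 // pi_gt0.
apply: h2dist_le => t.
have [-> -> ->] : has_derivatives (X s) (f s) (f' s) (f'' s) by near: s.
rewrite xg' xg'' xg; apply: sum3; move: (t); near: s;
  [exact: H|exact: H'|exact: H''].
Unshelve. all: by end_near. Qed.

Lemma sqnorm_combination_cvg {T : Type} (F : set_system T) {FF : Filter F}
    (a b : T -> R -> R) (a0 b0 : R -> R) A B (eps : R) :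
  unif_cvg F a a0 -> unif_cvg F b b0 -> 0 < eps ->
  \forall s \near F, forall t,
    sqnorm ((a0 t *: A + b0 t *: B) - (a s t *: A + b s t *: B)) < eps.
Proof.
move=> ha hb eps0.
(* The factors 2 come from [sqnormD] at l = 1; the 1 makes [K] positive and the final bound
   strict. *)
pose K := 2 * sqnorm A + 2 * sqnorm B + 1.
have A0 := Defs.sqnorm_ge0 A; have B0 := Defs.sqnorm_ge0 B.
have K0 : 0 < K by rewrite /K; lra.
pose d := Num.sqrt (eps / K).
have d0 : 0 < d by rewrite sqrtr_gt0 divr_gt0.
have d2 : d ^+ 2 * K = eps by rewrite sqr_sqrtr ?divfK ?gt_eqF // ltW // divr_gt0.
near=> s => t.
have h1 : `|a s t - a0 t| < d by move: (t); near: s; exact: ha.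
have h2 : `|b s t - b0 t| < d by move: (t); near: s; exact: hb.
have sq (u : R) : `|u| < d -> u ^+ 2 <= d ^+ 2.
  by move=> ud; rewrite -real_normK ?num_real // lerXn2r ?nnegrE // ltW.
have -> : a0 t *: A + b0 t *: B - (a s t *: A + b s t *: B) =
   (a0 t - a s t) *: A + (b0 t - b s t) *: B.
  by rewrite opprD addrACA -!scalerBl.
apply: le_lt_trans (Defs.sqnormD _ _ ltr01) _.
rewrite !sqnormZ invr1 -d2 /K.
have := ler_wpM2r A0 (sq _ h1); have := ler_wpM2r B0 (sq _ h2).
rewrite -(sqrrN (a0 t - _)) -(sqrrN (b0 t - _)) !opprB.
have : 0 < d ^+ 2 by rewrite exprn_gt0.
lra.
Unshelve. all: by end_near. Qed.

End H2_loops.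

(** * The gradient of the Newtonian potential *)

Lemma ord3P (k : 'I_3) : [\/ k = 0, k = 1 | k = 2].
Proof.
case: k => [[|[|[|//]]] h]; [apply: Or31|apply: Or32|apply: Or33]; exact: val_inj.
Qed.

Section gradient_of_potential.
Context {R : realType}.

(** Reduces directional derivatives of the potential to derivatives in one real variable, where
    composition with the square root can be differentiated. *)
Lemma is_derive_line (V : normedModType R) (f : V -> R) (x v : V) (l : R) :
  is_derive (0 : R) 1 (fun h => f (h *: v + x)) l -> is_derive x v f l.
Proof.
move=> [d e]; apply: DeriveDef; first exact/derivable1P.
rewrite -e /derive; congr (lim _).
suff -> : (fun h : R => h^-1 *: ((f \o shift x) (h *: v) - f x)) =
  (fun h : R => h^-1 *: (((fun h => f (h *: v + x)) \o shift 0) (h *: 1) -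
    f (0 *: v + x))) by [].
by apply/funext => h /=; rewrite addr0 scale0r add0r [h *: 1]mulr1.
Qed.

Lemma is_derive_bigsum (V : normedModType R) (I : Type) (r : seq I) (P : pred I)
    (h : I -> V -> R) (dh : I -> R) (x v : V) :
  (forall i, P i -> is_derive x v (h i) (dh i)) ->
  is_derive x v (fun y => \sum_(i <- r | P i) h i y) (\sum_(i <- r | P i) dh i).
Proof.
move=> H; rewrite -fct_sumE.
elim/big_rec2: _ => [|i d f Pi hf]; first exact: is_derive_cst.
exact: is_deriveD (H i Pi) hf.
Qed.

Lemma is_derive_affine (c w h : R) : is_derive h 1 (fun h => c + h * w) w.
Proof.
have hw : is_derive h 1 (w \*: id) w.
  by apply: (is_derive_eq (is_deriveZ w (is_derive_id h 1))); rewrite /GRing.scale /= mulr1.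
have -> : (fun h => c + h * w) = cst c + (w \*: id).
  by apply/funext => s; rewrite fctE /= mulrC.
by apply: (is_derive_eq (is_deriveD (is_derive_cst c h 1) hw)); rewrite add0r.
Qed.

Lemma is_derive_enormV (c w : 'rV[R]_3) : c != 0 ->
  is_derive (0 : R) 1 (fun h => (enorm (h *: w + c))^-1)
    (- (\sum_k c 0 k * w 0 k) * (enorm c)^-1 ^+ 3).
Proof.
move=> c0.
pose S h := \sum_k (c 0 k + h * w 0 k) ^+ 2.
have S0 : S 0 = \sum_k c 0 k ^+ 2.
  by apply: eq_bigr => k _; rewrite mul0r addr0.
have Spos : 0 < S 0.
  rewrite S0 lt_neqAle sumr_ge0 => [|k _]; last exact: sqr_ge0.
  rewrite andbT eq_sym psumr_eq0 => [|k _]; last exact: sqr_ge0.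
  apply: contra c0 => /allP H; apply/eqP/rowP => k; rewrite mxE.
  by have := H k (mem_index_enum _); rewrite sqrf_eq0 => /eqP.
have dS : is_derive (0 : R) 1 S (\sum_k (c 0 k * w 0 k *+ 2)).
  apply: is_derive_bigsum => k _.
  have hl := is_derive_affine (c 0 k) (w 0 k) 0.
  apply: (is_derive_eq (is_deriveM hl hl)).
  by rewrite /GRing.scale /= mul0r addr0 mulr2n.
have ds := is_derive1_comp (f := Num.sqrt) (is_derive1_sqrt Spos) dS.
have e0 : Num.sqrt (S 0) = enorm c by rewrite S0.
have n0 : (Num.sqrt \o S) 0 != 0 by rewrite /= gt_eqF // sqrtr_gt0.
have dV := is_deriveV n0 ds.
have -> : (fun h => (enorm (h *: w + c))^-1) = (fun y => ((Num.sqrt \o S) y)^-1).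
  apply/funext => h; congr (Num.sqrt _)^-1; apply: eq_bigr => k _.
  by rewrite !mxE addrC.
apply: (is_derive_eq dV); rewrite /GRing.scale /= e0.
have -> : \sum_k c 0 k * w 0 k *+ 2 = 2 * \sum_k c 0 k * w 0 k.
  by rewrite mulr_sumr; apply: eq_bigr => k _; rewrite mulr_natl.
by field; move: n0; rewrite /= e0.
Qed.

(** Moving the body [j0] changes only the pairs containing it, with a sign given by its place in the
    pair. Antisymmetry, that is action and reaction, merges both cases into one sum over all
    bodies. *)
Lemma sum_ltn_antisym (N : nat) (F : 'I_N -> 'I_N -> R) (j0 : 'I_N) :
  (forall i j, F i j = - F j i) ->
  \sum_(i < N) \sum_(j < N | (i < j)%N) F i j * ((j == j0)%:R - (i == j0)%:R) =
  \sum_(i < N) F i j0.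
Proof.
move=> FN.
have d0 : F j0 j0 = 0 by have := FN j0 j0; lra.
have -> : \sum_(i < N) F i j0 = \sum_(i < N) (if (i < j0)%N then F i j0 else 0)
   - \sum_(i < N) (if (j0 < i)%N then F j0 i else 0).
  rewrite -sumrB; apply: eq_bigr => i _.
  case: ltngtP => [_|_|/val_inj ->]; last by rewrite subrr.
    by rewrite subr0.
  by rewrite sub0r -FN.
have pick (i : 'I_N) (G : 'I_N -> R) : \sum_(j < N) G j * (j == i)%:R = G i.
  rewrite (bigD1 i) //= eqxx mulr1 big1 ?addr0 // => j /negPf ->.
  by rewrite mulr0.
rewrite -[X in _ - X](pick j0 (fun j => \sum_(i < N) if (j < i)%N then F j i else 0)).
rewrite -sumrB; apply: eq_bigr => i _.
rewrite -(pick j0 (fun j => if (i < j)%N then F i j else 0)) mulr_suml -sumrB.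
rewrite big_mkcond; apply: eq_bigr => j _.
by case: ifP => _; rewrite ?mulrBr // !mul0r subr0.
Qed.

End gradient_of_potential.

Section newtonian_gradient.
Context {R : realType} (n : nat) (mu : R).
Local Notation N := (nbodies n mu).
Implicit Types (x v : 'M[R]_(N, 3)) (i j : 'I_N) (k : 'I_3).

Definition planar_coord (k : 'I_3) : R := (k != 2)%:R.

(** The term [i = j] is zero because of the difference of positions. Factoring out [mass j] prepares
    the common factor [massmx] of Newton's equation. *)
Lemma gradient_potentialE x j k : ~ collision x ->
  gradient (@potential R n mu) x j k =
  mass j * (omega n mu * planar_coord k * x j k +
    \sum_i mass i * (x i k - x j k) * (enorm (row i x - row j x))^-1 ^+ 3).
Proof.
move=> ncol; rewrite mxE; set v := delta_mx j k; apply: derive_val.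
pose d1 i := 2 * planar_coord k * x j k * (i == j)%:R * mass i.
pose D i i' : R := (enorm (row i x - row i' x))^-1 ^+ 3.
have DC i i' : D i i' = D i' i.
  rewrite /D; congr ((Num.sqrt _)^-1 ^+ 3); apply: eq_bigr => l _.
  by rewrite -opprB mxE sqrrN.
(* The component [k] of the attraction exerted on [i'] by [i]. *)
pose F i i' := mass i * mass i' * (x i k - x i' k) * D i i'.
apply: is_derive_line.
have h1 : is_derive (0 : R) 1
    (fun h => omega n mu / 2 * (\sum_i mass i * ((h *: v + x) i 0 ^+ 2 + (h *: v + x) i 1 ^+ 2)))
    (omega n mu / 2 * \sum_i d1 i).
  suff hs : is_derive (0 : R) 1 (fun h => \sum_i mass i *
      ((h *: v + x) i 0 ^+ 2 + (h *: v + x) i 1 ^+ 2)) (\sum_i d1 i).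
    by apply: (is_derive_eq (is_deriveZ (omega n mu / 2) hs)).
  apply: is_derive_bigsum => i _.
  have coord l : is_derive (0 : R) 1 (fun h => (h *: v + x) i l ^+ 2)
     (2 * x i l * v i l).
    have hl := is_derive_affine (x i l) (v i l) 0.
    have -> : (fun h => (h *: v + x) i l ^+ 2) =
        (fun h => x i l + h * v i l) * (fun h => x i l + h * v i l).
      by apply/funext => h; rewrite fctE /= !mxE addrC expr2.
    apply: (is_derive_eq (is_deriveM hl hl)).
    by rewrite /GRing.scale /=; ring.
  apply: (is_derive_eq (is_deriveZ (mass i) (is_deriveD (coord 0) (coord 1)))).
  rewrite /GRing.scale /= /d1 !mxE /planar_coord.
  case: (eqVneq i j) => [->|_] /=; last by rewrite !mulr0 !mul0r addr0 mulr0.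
  by case: (ord3P k) => ->; rewrite -!val_eqE /=; ring.
have h2 : is_derive (0 : R) 1 (fun h => \sum_(i < N) \sum_(i' < N | (i < i')%N)
      mass i * mass i' * (enorm (row i' (h *: v + x) - row i (h *: v + x)))^-1)
    (\sum_(i < N) \sum_(i' < N | (i < i')%N) F i i' * ((i' == j)%:R - (i == j)%:R)).
  apply: is_derive_bigsum => i _; apply: is_derive_bigsum => i' ii'.
  have c0 : row i' x - row i x != 0.
    rewrite subr_eq0; apply/eqP => e; apply: ncol; exists i', i; split=> //.
    by rewrite -val_eqE /= gtn_eqF.
  have he := is_derive_enormV (row i' v - row i v) c0.
  have -> : (fun h => mass i * mass i' *
        (enorm (row i' (h *: v + x) - row i (h *: v + x)))^-1) =
     (mass i * mass i') \*: (fun h => (enorm (h *: (row i' v - row i v) +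
          (row i' x - row i x)))^-1).
    apply/funext => h; congr (_ * (enorm _)^-1).
    by apply/rowP => l; rewrite !mxE; ring.
  apply: (is_derive_eq (is_deriveZ (mass i * mass i') he)).
  rewrite /GRing.scale /= /F -/(D i' i) DC.
  rewrite (bigD1 k) //= big1 => [|l lk]; last first.
    by rewrite !mxE (negPf lk) !andbF subrr mulr0.
  by rewrite !mxE eqxx !andbT; ring.
have FN i i' : F i i' = - F i' i by rewrite /F DC; ring.
apply: (is_derive_eq (is_deriveD h1 h2)).
rewrite (sum_ltn_antisym j FN) (bigD1 j) //= big1 => [|i /negPf ij]; last first.
  by rewrite /d1 ij mulr0 mul0r.
rewrite /d1 eqxx addr0 mulr1 [RHS]mulrDr mulr_sumr; congr (_ + _); first by field.
by apply: eq_bigr => i _; rewrite /F /D; ring.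
Qed.

End newtonian_gradient.

(** * The attraction of a regular polygon *)

Section sums_over_polygon.
Context {R : realType} (n : nat) (hn : (3 <= n)%N).
Local Notation zeta := (zeta R n).
Implicit Types (f : R -> R) (l m : nat).

Let n0 : n%:R != 0 :> R.
Proof. by rewrite pnatr_eq0 -lt0n (leq_trans _ hn). Qed.

Lemma zeta_muln : n%:R * zeta = 2 * pi.
Proof. by rewrite /Defs.zeta mulrC divfK. Qed.

Lemma sum_periodic_shift f m : (forall t, f (t + 2 * pi) = f t) ->
  \sum_(1 <= l < n.+1) f (l%:R * zeta - m%:R * zeta) =
  \sum_(1 <= l < n.+1) f (l%:R * zeta).
Proof.
move=> fp.
have step c : \sum_(1 <= l < n.+1) f (l%:R * zeta + (c - zeta)) =
    \sum_(1 <= l < n.+1) f (l%:R * zeta + c).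
  rewrite big_add1 /=.
  have -> : \sum_(0 <= l < n) f (l.+1%:R * zeta + (c - zeta)) =
      \sum_(0 <= l < n) f (l%:R * zeta + c).
    by apply: eq_bigr => l _; congr f; rewrite -natr1; ring.
  (* Adding the term [l = n] on both sides makes the ranges agree up to the term [l = 0], which
     equals it by periodicity. *)
  apply: (addIr (f (n%:R * zeta + c))).
  rewrite -(big_nat_recr _ _ (fun l => f (l%:R * zeta + c))) //= big_ltn // addrC.
  by rewrite zeta_muln (addrC (2 * pi)) fp mul0r add0r.
elim: m => [|m IH]; first by apply: eq_bigr => l _; rewrite mul0r subr0.
rewrite -IH -(step (- (m%:R * zeta))); apply: eq_bigr => l _; congr f; rewrite -natr1; ring.
Qed.

Lemma sum_periodic_odd f : (forall t, f (t + 2 * pi) = f t) ->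
  (forall t, f (- t) = - f t) -> \sum_(1 <= l < n.+1) f (l%:R * zeta) = 0.
Proof.
move=> fp fN; suff : \sum_(1 <= l < n.+1) f (l%:R * zeta) =
  - \sum_(1 <= l < n.+1) f (l%:R * zeta) by lra.
(* Reversing the range sends l to n + 1 - l; with a shift by one vertex this is l to n - l, the
   negation of the angle modulo 2 pi. *)
rewrite -{2}(sum_periodic_shift 1 fp) -sumrN big_nat_rev /=.
apply: eq_big_nat => l /andP[l1 ln].
rewrite -fN -(fp (- _)) -zeta_muln; congr f.
rewrite add1n subSS natrB 1?ltnW //.
by rewrite mul1r opprB -natr1; ring.
Qed.

Lemma half_zeta_itv m : (0 < m < n)%N -> 0 < m%:R * zeta / 2 < pi.
Proof.
move=> /andP[m0 mn]; rewrite /Defs.zeta.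
have -> : m%:R * (2 * pi / n%:R) / 2 = pi * (m%:R / n%:R) :> R by field.
have n1 : 0 < n%:R :> R by rewrite ltr0n (leq_trans _ hn).
have pi0 := pi_gt0 R; apply/andP; split.
  by rewrite mulr_gt0 // divr_gt0 // ltr0n.
by rewrite gtr_pMr // ltr_pdivrMr // mul1r ltr_nat.
Qed.

Lemma sin_half_zeta_gt0 m : (0 < m < n)%N -> 0 < sin (m%:R * zeta / 2).
Proof. by move=> /half_zeta_itv/sin_gt0_pi. Qed.

Lemma cos_sub1 t : cos t - 1 = - (2 * sin (t / 2) ^+ 2) :> R.
Proof.
have -> : cos t = cos (t / 2 + t / 2) by congr cos; field.
by rewrite cosD -expr2 cos2sin2; ring.
Qed.

Lemma cos_zeta_neq1 : cos zeta != 1.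
Proof.
rewrite -subr_eq0 cos_sub1 oppr_eq0 mulf_neq0 // expf_neq0 // gt_eqF //.
have := @sin_half_zeta_gt0 1; rewrite mul1r; apply.
by rewrite (leq_trans _ hn).
Qed.

Lemma sum_sin_zeta : \sum_(1 <= l < n.+1) sin (l%:R * zeta) = 0.
Proof. exact: sum_periodic_odd (@sin_add2pi R) (@sinN R). Qed.

(** Rotating the vertices by [zeta] leaves the sum unchanged and, the sines summing to 0, also
    multiplies it by cos zeta, which is not 1. *)
Lemma sum_cos_zeta : \sum_(1 <= l < n.+1) cos (l%:R * zeta) = 0.
Proof.
have := sum_periodic_shift 1 (@cos_add2pi R).
under eq_bigr do rewrite mul1r cosB.
rewrite big_split /= -!mulr_suml sum_sin_zeta mul0r addr0.
set C := \sum_(1 <= l < n.+1) _ => h.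
have /eqP : C * (cos zeta - 1) = 0 by rewrite mulrBr h mulr1 subrr.
by rewrite mulf_eq0 subr_eq0 (negPf cos_zeta_neq1) orbF => /eqP.
Qed.

(** The inverse cube of the chord of angle [t] in a circle of radius [rho]. At multiples of 2 pi it
    is 0, and so are the factors sin t and cos t - 1 in front of it: a vertex does not attract
    itself. *)
Let kernel rho t : R := (2 * rho * `|sin (t / 2)|)^-1 ^+ 3.

Let kernelD2pi rho t : kernel rho (t + 2 * pi) = kernel rho t.
Proof.
rewrite /kernel; have -> : (t + 2 * pi) / 2 = t / 2 + pi by field.
by rewrite sinDpi normrN.
Qed.

Let kernelN rho t : kernel rho (- t) = kernel rho t.
Proof. by rewrite /kernel mulNr sinN normrN. Qed.

(** The tangential attractions cancel because the polygon is symmetric about the axis through each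
    vertex. *)
Lemma sum_kernel_sin rho m : \sum_(1 <= l < n.+1)
    sin (l%:R * zeta - m%:R * zeta) * kernel rho (l%:R * zeta - m%:R * zeta) = 0.
Proof.
rewrite (sum_periodic_shift (f := fun t => sin t * kernel rho t)) => [|t].
  apply: (sum_periodic_odd (f := fun t => sin t * kernel rho t)) => t.
    by rewrite sin_add2pi kernelD2pi.
  by rewrite sinN kernelN mulNr.
by rewrite sin_add2pi kernelD2pi.
Qed.

(** The origin of [s_ R n 1]: as cos t - 1 = - 2 sin^2 (t/2), each radial term is - 1 / (4 rho^3 sin
    (t/2)), and the term [l = n] vanishes. *)
Lemma sum_kernel_cos rho m : 0 < rho -> \sum_(1 <= l < n.+1)
    (cos (l%:R * zeta - m%:R * zeta) - 1) * kernel rho (l%:R * zeta - m%:R * zeta) =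
  - s_ R n 1 / rho ^+ 3.
Proof.
move=> rho0.
rewrite (sum_periodic_shift (f := fun t => (cos t - 1) * kernel rho t)) => [|t]; last first.
  by rewrite cos_add2pi kernelD2pi.
rewrite big_nat_recr ?(leq_trans _ hn) //= zeta_muln -[2 * pi]add0r cos_add2pi cos0.
rewrite subrr mul0r addr0 /s_ -mulNr mulr_sumr mulr_suml.
apply: eq_big_nat => l ln; have s0 := sin_half_zeta_gt0 ln.
rewrite mul1r cos_sub1 /kernel gtr0_norm //.
by field; rewrite !gt_eqF.
Qed.

End sums_over_polygon.

(** * Polygons multiplied by a complex number *)

Section homothetic_configurations.
Context {R : realType} (n : nat) (mu : R) (hn : (3 <= n)%N).
Local Notation N := (nbodies n mu).
Local Notation zeta := (zeta R n).
Implicit Types (a b : R) (i j : 'I_N) (l m : nat).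

(** The polygon times a + ib. These configurations form a linear space stable under [Jbar], so on
    them Newton's equation becomes two scalar equations for [a] and [b]. *)
Definition homothetic a b : 'M[R]_(N, 3) :=
  a *: polygon n mu + b *: on_bodies (Jbar R) (polygon n mu).

Lemma homotheticD a b a' b' :
  homothetic a b + homothetic a' b' = homothetic (a + a') (b + b').
Proof. by rewrite /homothetic !scalerDl addrACA. Qed.

Lemma homotheticZ c a b : c *: homothetic a b = homothetic (c * a) (c * b).
Proof. by rewrite /homothetic scalerDr !scalerA. Qed.

Lemma homothetic0 : homothetic 0 0 = 0.
Proof. by rewrite /homothetic !scale0r addr0. Qed.

Lemma homothetic10 : homothetic 1 0 = polygon n mu.
Proof. by rewrite /homothetic scale1r scale0r addr0. Qed.

(** Coordinates as functions of the label rather than of the row, so that sums run over 0, ..., n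
    whether or not the central body is present. *)
Definition pos_x a b l := if l == 0%N then 0 else spin_x (l%:R * zeta) a b.
Definition pos_y a b l := if l == 0%N then 0 else spin_y (l%:R * zeta) a b.

Lemma on_bodiesE (A : 'M[R]_3) (x : 'M[R]_(N, 3)) i k :
  on_bodies A x i k = x i 0 * A k 0 + x i 1 * A k 1 + x i 2 * A k 2.
Proof.
rewrite mxE !big_ord_recl big_ord0 addr0 addrA !mxE.
by congr (_ + _ + _); congr (x i _ * A k _); exact: val_inj.
Qed.

Lemma homothetic_x a b i : homothetic a b i 0 = pos_x a b (label i).
Proof.
rewrite [LHS]mxE [X in X + _]mxE [X in _ + X]mxE on_bodiesE !mxE /= /pos_x /spin_x.
by case: eqP => _; ring.
Qed.

Lemma homothetic_y a b i : homothetic a b i 1 = pos_y a b (label i).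
Proof.
rewrite [LHS]mxE [X in X + _]mxE [X in _ + X]mxE on_bodiesE !mxE /= /pos_y /spin_y.
by case: eqP => _; ring.
Qed.

Lemma homothetic_z a b i : homothetic a b i 2 = 0.
Proof.
rewrite [LHS]mxE [X in X + _]mxE [X in _ + X]mxE on_bodiesE !mxE /=.
by case: eqP => _; ring.
Qed.

Let dist a b l m := Num.sqrt
  ((pos_x a b l - pos_x a b m) ^+ 2 + (pos_y a b l - pos_y a b m) ^+ 2).

Lemma enorm_rowB (x : 'M[R]_(N, 3)) i j : enorm (row i x - row j x) =
  Num.sqrt ((x i 0 - x j 0) ^+ 2 + (x i 1 - x j 1) ^+ 2 + (x i 2 - x j 2) ^+ 2).
Proof.
rewrite /enorm !big_ord_recl big_ord0 addr0 addrA !mxE; congr (Num.sqrt (_ + _ + _)).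
  by congr ((x i _ - x j _) ^+ 2); exact: val_inj.
by congr ((x i _ - x j _) ^+ 2); exact: val_inj.
Qed.

Let enorm_homothetic a b i j :
  enorm (row i (homothetic a b) - row j (homothetic a b)) = dist a b (label i) (label j).
Proof.
rewrite enorm_rowB !homothetic_x !homothetic_y !homothetic_z.
by rewrite subrr expr0n addr0.
Qed.

Let distC a b l m : dist a b l m = dist a b m l.
Proof. by rewrite /dist -opprB sqrrN -(opprB (pos_y a b l)) sqrrN. Qed.

Let dist_center a b m : (0 < m)%N -> dist a b 0 m = Num.sqrt (a ^+ 2 + b ^+ 2).
Proof.
case: m => // m _; rewrite /dist /pos_x /pos_y /= !sub0r !sqrrN.
by rewrite sqr_norm_cos_sin.
Qed.

Let sqr_chord a b s t :
  (spin_x s a b - spin_x t a b) ^+ 2 + (spin_y s a b - spin_y t a b) ^+ 2 =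
  (a ^+ 2 + b ^+ 2) * (2 * sin ((s - t) / 2)) ^+ 2.
Proof.
have -> : (2 * sin ((s - t) / 2)) ^+ 2 = 2 - 2 * cos (s - t).
  by have := cos_sub1 (s - t); lra.
rewrite /spin_x /spin_y cosB.
have := cos2Dsin2 s; have := cos2Dsin2 t.
move: (cos s) (sin s) (cos t) (sin t) => c d c' d' h h'.
(* The constant 2 is replaced by two sums cos^2 + sin^2, after which the identity is homogeneous and
   polynomial. *)
have -> : 2 - 2 * (c * c' + d * d') =
  (c ^+ 2 + d ^+ 2) + (c' ^+ 2 + d' ^+ 2) - 2 * (c * c' + d * d').
  by rewrite h h'; ring.
ring.
Qed.

Let dist_polygon a b l m : (0 < l)%N -> (0 < m)%N -> dist a b l m =
  2 * Num.sqrt (a ^+ 2 + b ^+ 2) * `|sin ((l%:R * zeta - m%:R * zeta) / 2)|.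
Proof.
case: l => // l _; case: m => // m _; rewrite /dist /pos_x /pos_y /= sqr_chord.
rewrite sqrtrM ?addr_ge0 ?sqr_ge0 // sqrtr_sqr normrM ger0_norm //.
by rewrite mulrCA mulrA.
Qed.

Lemma label_le_n i : (label i <= n)%N.
Proof. exact: Defs.label_le. Qed.

Let label_inj : injective (@label R n mu).
Proof. by move=> i j /addIn /val_inj. Qed.

Let norm_gt0 a b : 0 < a ^+ 2 + b ^+ 2 -> 0 < Num.sqrt (a ^+ 2 + b ^+ 2).
Proof. by rewrite sqrtr_gt0. Qed.

Lemma homothetic_collision_free a b : 0 < a ^+ 2 + b ^+ 2 ->
  ~ collision (homothetic a b).
Proof.
move=> /norm_gt0 r0.
suff H i j : (label i < label j)%N -> row i (homothetic a b) <> row j (homothetic a b).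
  move=> [i [j [ij e]]]; case: (ltngtP (label i) (label j)) => [h|h|/label_inj].
  - exact: H h e.
  - exact: H h (esym e).
  - by move/eqP: ij.
move=> ij e; have : dist a b (label i) (label j) = 0.
  rewrite -enorm_homothetic e subrr /enorm big1 ?sqrtr0 // => k _.
  by rewrite mxE expr0n.
have j0 : (0 < label j)%N by exact: leq_ltn_trans ij.
case: (posnP (label i)) => [->|i0].
  by rewrite dist_center // => d0; move: r0; rewrite d0 ltxx.
rewrite dist_polygon //.
have -> : (label i)%:R * zeta - (label j)%:R * zeta =
   - ((label j - label i)%N%:R * zeta) by rewrite natrB 1?ltnW //; ring.
rewrite mulNr sinN normrN; move/eqP; rewrite mulf_eq0 normr_eq0 gt_eqF ?mulr_gt0 //=.
rewrite gt_eqF // sin_half_zeta_gt0 // subn_gt0 ij /=.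
by apply: leq_trans (label_le_n j); rewrite ltn_subrL i0.
Qed.

(** One formula for both cases: when the central body is omitted, its term has weight mu = 0. *)
Lemma sum_massM (G : nat -> R) :
  \sum_i mass i * G (@label R n mu i) = mu * G 0 + \sum_(1 <= l < n.+1) G l.
Proof.
pose h (l : nat) := (if l == 0%N then mu else 1) * G l.
have -> : mu * G 0 + \sum_(1 <= l < n.+1) G l = \sum_(0 <= l < n.+1) h l.
  rewrite [RHS]big_ltn // /h /=; congr (_ + _); apply: eq_big_nat => -[//|l] _.
  by rewrite mul1r.
rewrite -(big_mkord xpredT (fun l => h (l + (mu == 0%R))%N)) /nbodies.
case: (eqVneq mu 0) => [m0|_] /=.
  have h0 : h 0%N = 0 by rewrite /h m0 mul0r.
  rewrite add0n [RHS]big_ltn // h0 add0r [RHS]big_add1 /=.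
  by apply: eq_bigr => l _; rewrite addn1.
by rewrite add1n; apply: eq_bigr => l _; rewrite addn0.
Qed.

(** Write z_l - z_m = z_m (e^{it} - 1) with t the angle from vertex m to vertex l: the sine part
    sums to 0, the cosine part gives the share s_1, and the central body adds mu. At the centre
    itself the attractions of the vertices cancel. *)
Let force_x a b m : 0 < a ^+ 2 + b ^+ 2 ->
  mu * ((pos_x a b 0 - pos_x a b m) * (dist a b 0 m)^-1 ^+ 3) +
  \sum_(1 <= l < n.+1) (pos_x a b l - pos_x a b m) * (dist a b l m)^-1 ^+ 3 =
  - omega n mu * pos_x a b m * (Num.sqrt (a ^+ 2 + b ^+ 2))^-1 ^+ 3.
Proof.
move=> /norm_gt0 r0; case: (posnP m) => [->|m0].
  rewrite {1}/pos_x eqxx subrr mul0r mulr0 add0r mulr0 mul0r.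
  under eq_big_nat => l /andP[l0 _].
    rewrite distC dist_center // subr0 /pos_x gtn_eqF // /spin_x mulrBl.
    rewrite -mulrA -[_ * b * _]mulrA; over.
  by rewrite sumrB -!mulr_suml sum_cos_zeta // sum_sin_zeta // !mul0r subr0.
rewrite dist_center //; set rho := Num.sqrt _ in r0 *.
pose K t := (2 * rho * `|sin (t / 2)|)^-1 ^+ 3.
have -> : \sum_(1 <= l < n.+1) (pos_x a b l - pos_x a b m) * (dist a b l m)^-1 ^+ 3 =
  pos_x a b m * (\sum_(1 <= l < n.+1)
    (cos (l%:R * zeta - m%:R * zeta) - 1) * K (l%:R * zeta - m%:R * zeta))
  - pos_y a b m * (\sum_(1 <= l < n.+1)
    sin (l%:R * zeta - m%:R * zeta) * K (l%:R * zeta - m%:R * zeta)).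
  rewrite !mulr_sumr -sumrB; apply: eq_big_nat => l /andP[l0 _].
  rewrite dist_polygon // -/rho -/(K _) /pos_x /pos_y !gtn_eqF //.
  have -> : l%:R * zeta = m%:R * zeta + (l%:R * zeta - m%:R * zeta) by ring.
  move: (l%:R * zeta - m%:R * zeta) => t.
  have -> : m%:R * zeta + t - m%:R * zeta = t by ring.
  by rewrite /spin_x /spin_y cosD sinD; ring.
rewrite sum_kernel_cos // sum_kernel_sin // mulr0 subr0 {1}/pos_x eqxx sub0r /omega.
by field; rewrite gt_eqF.
Qed.

(** Reduced to [force_x] by multiplying the configuration by -i, that is by replacing (a, b) with
    (b, -a). *)
Let force_y a b m : 0 < a ^+ 2 + b ^+ 2 ->
  mu * ((pos_y a b 0 - pos_y a b m) * (dist a b 0 m)^-1 ^+ 3) +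
  \sum_(1 <= l < n.+1) (pos_y a b l - pos_y a b m) * (dist a b l m)^-1 ^+ 3 =
  - omega n mu * pos_y a b m * (Num.sqrt (a ^+ 2 + b ^+ 2))^-1 ^+ 3.
Proof.
have quarter l : (pos_y a b l = pos_x b (- a) l) * (pos_x a b l = - pos_y b (- a) l).
  by rewrite /pos_x /pos_y /spin_x /spin_y; split; case: eqP => _; ring.
have distE l l' : dist a b l l' = dist b (- a) l l'.
  rewrite /dist !quarter; congr Num.sqrt.
  by ring.
have s2 : a ^+ 2 + b ^+ 2 = b ^+ 2 + (- a) ^+ 2 by rewrite sqrrN addrC.
move=> r0; rewrite s2 !quarter distE.
rewrite -force_x //; last by rewrite -s2.
by congr (_ + _); apply: eq_bigr => l _; rewrite !quarter distE.
Qed.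

Lemma gradient_homothetic a b : 0 < a ^+ 2 + b ^+ 2 ->
  gradient (@potential R n mu) (homothetic a b) =
  massmx n mu *m ((omega n mu * (1 - (Num.sqrt (a ^+ 2 + b ^+ 2))^-1 ^+ 3)) *:
     homothetic a b).
Proof.
move=> r0; apply/matrixP => j k.
rewrite gradient_potentialE; last exact: homothetic_collision_free.
rewrite /massmx mul_diag_mx [RHS]mxE [X in _ = X * _]mxE; congr (_ * _).
rewrite [RHS]mxE /planar_coord.
have sumE (p : nat -> R) : (forall i, homothetic a b i k = p (label i)) ->
    \sum_i mass i * (homothetic a b i k - homothetic a b j k) *
      (enorm (row i (homothetic a b) - row j (homothetic a b)))^-1 ^+ 3 =
    mu * ((p 0%N - p (label j)) * (dist a b 0 (label j))^-1 ^+ 3) +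
    \sum_(1 <= l < n.+1) (p l - p (label j)) * (dist a b l (label j))^-1 ^+ 3.
  move=> hp; rewrite -(sum_massM (fun l => (p l - p (label j)) *
    (dist a b l (label j))^-1 ^+ 3)).
  by apply: eq_bigr => i _; rewrite !hp enorm_homothetic mulrA.
case: (ord3P k) sumE => -> sumE.
- rewrite (sumE _ (homothetic_x a b)) force_x // homothetic_x.
  by rewrite -val_eqE /=; ring.
- rewrite (sumE _ (homothetic_y a b)) force_y // homothetic_y.
  by rewrite -val_eqE /=; ring.
rewrite eqxx mulr0 mul0r add0r homothetic_z mulr0 big1 // => i _.
by rewrite homothetic_z subr0 mulr0 mul0r.
Qed.

End homothetic_configurations.

(** * Symmetries *)

Section symmetries_of_homothetic_loops.
Context {R : realType} (n : nat) (mu : R) (hn : (3 <= n)%N).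
Local Notation N := (nbodies n mu).
Local Notation zeta := (zeta R n).
Local Notation shift := (Defs.shift n mu).
Implicit Types (x : 'M[R]_(N, 3)) (i : 'I_N) (k : nat).

Lemma on_bodies_mulmx (A B : 'M[R]_3) x :
  on_bodies (A *m B) x = on_bodies A (on_bodies B x).
Proof. by rewrite /on_bodies trmx_mul mulmxA. Qed.

Lemma on_bodies_rot (t : R) x i :
  [/\ on_bodies (Defs.rot t) x i 0 = spin_x t (x i 0) (x i 1),
      on_bodies (Defs.rot t) x i 1 = spin_y t (x i 0) (x i 1)
    & on_bodies (Defs.rot t) x i 2 = x i 2].
Proof.
by split; rewrite on_bodiesE /Defs.rot /mx3 !mxE /= /spin_x /spin_y; ring.
Qed.

Lemma on_bodies_kappa x i :
  [/\ on_bodies (kappa R) x i 0 = x i 0, on_bodies (kappa R) x i 1 = x i 1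
    & on_bodies (kappa R) x i 2 = - x i 2].
Proof. by split; rewrite on_bodiesE /kappa /mx3 !mxE /=; ring. Qed.

Lemma spin_xD s t (a b : R) :
  spin_x s (spin_x t a b) (spin_y t a b) = spin_x (s + t) a b.
Proof. by rewrite /spin_x /spin_y cosD sinD; ring. Qed.

Lemma spin_yD s t (a b : R) :
  spin_y s (spin_x t a b) (spin_y t a b) = spin_y (s + t) a b.
Proof. by rewrite /spin_x /spin_y cosD sinD; ring. Qed.

Lemma spin_x0 (a b : R) : spin_x 0 a b = a.
Proof. by rewrite /spin_x cos0 sin0; ring. Qed.

Lemma spin_y0 (a b : R) : spin_y 0 a b = b.
Proof. by rewrite /spin_y cos0 sin0; ring. Qed.

Lemma label_shift i : label (shift i) = next_label n (label i).
Proof.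
rewrite /Defs.shift permE /label /=.
exact: subnK (Defs.next_label_ge _ (Defs.label_ge i)).
Qed.

Lemma label_shift_iter k i : label i = 1%N -> (k < n)%N ->
  label ((shift ^+ k)%g i) = k.+1.
Proof.
move=> i1; elim: k => [|k IH] kn; first by rewrite expg0 perm1.
by rewrite expgSr permM label_shift IH ?(ltnW kn) // /next_label /= modn_small.
Qed.

Lemma pos_shift (a b : R) k i :
  pos_x n a b (label ((shift ^+ k)%g i)) =
    spin_x (k%:R * zeta) (pos_x n a b (label i)) (pos_y n a b (label i)) /\
  pos_y n a b (label ((shift ^+ k)%g i)) =
    spin_y (k%:R * zeta) (pos_x n a b (label i)) (pos_y n a b (label i)).
Proof.
have next l : (l <= n)%N ->
    pos_x n a b (next_label n l) = spin_x zeta (pos_x n a b l) (pos_y n a b l) /\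
    pos_y n a b (next_label n l) = spin_y zeta (pos_x n a b l) (pos_y n a b l).
  rewrite /next_label /pos_x /pos_y; case: l => [|l] ln /=.
    by rewrite /spin_x /spin_y; split; ring.
  rewrite spin_xD spin_yD.
  have -> : zeta + l.+1%:R * zeta = l.+2%:R * zeta by rewrite -[l.+2%:R]natr1; ring.
  case: (ltngtP l.+1 n) ln => // [ln|ln] _; first by rewrite modn_small.
  (* The label [n] wraps round to 1, a full turn. *)
  have -> : l.+2%:R * zeta = zeta + 2 * pi.
    by rewrite -[l.+2%:R]natr1 mulrDl mul1r ln zeta_muln // addrC.
  by rewrite ln modnn mul1r /spin_x /spin_y cos_add2pi sin_add2pi.
elim: k => [|k [IHx IHy]]; first by rewrite expg0 perm1 mul0r spin_x0 spin_y0.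
rewrite expgSr permM label_shift.
have [-> ->] := next _ (label_le_n ((shift ^+ k)%g i)).
rewrite IHx IHy spin_xD spin_yD.
by have -> : zeta + k%:R * zeta = k.+1%:R * zeta by rewrite -natr1; ring.
Qed.

(** The time shifts in [Zn_Z2] are whole numbers of periods, so they act trivially on periodic
    loops. *)
Lemma periodic_sub_period (T : Type) (x : R -> T) t k :
  (forall t, x (t + 2 * pi) = x t) -> x (t - k%:R * (n%:R * zeta)) = x t.
Proof.
move=> xp; rewrite zeta_muln //; elim: k => [|k IH].
  by rewrite mul0r subr0.
by rewrite -IH -(xp (t - k.+1%:R * _)) -natr1; congr x; ring.
Qed.

Lemma homothetic_symmetries (a b : R -> R) :
  (forall t, a (t + 2 * pi) = a t) -> (forall t, b (t + 2 * pi) = b t) ->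
  has_symmetries (Zn_Z2 n mu) (fun t => homothetic n mu (a t) (b t)).
Proof.
move=> pa pb _ [k [f ->]]; apply/funext => t; rewrite /Defs.act /=.
rewrite (periodic_sub_period (x := fun t => homothetic n mu (a t) (b t))); last first.
  by move=> s; rewrite pa pb.
move: (a t) (b t) => {pa pb} p q.
set X := homothetic n mu p q; set Y := row_perm _ X.
have YE i c : Y i c = X ((shift ^+ k)%g i) c by rewrite mxE.
have [Yx Yy] : (forall i, on_bodies (Defs.rot (- (k%:R * zeta))) Y i 0 = X i 0) /\
    (forall i, on_bodies (Defs.rot (- (k%:R * zeta))) Y i 1 = X i 1).
  split=> i; have [ex ey _] := on_bodies_rot (- (k%:R * zeta)) Y i;
  have [Px Py] := pos_shift p q k i.
    rewrite ex !YE !homothetic_x !homothetic_y Px Py spin_xD addNr.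
    exact: spin_x0.
  rewrite ey !YE !homothetic_x !homothetic_y Px Py spin_yD addNr.
  exact: spin_y0.
have Yz i : on_bodies (Defs.rot (- (k%:R * zeta))) Y i 2 = 0.
  have [_ _ ->] := on_bodies_rot (- (k%:R * zeta)) Y i.
  by rewrite /Y mxE homothetic_z.
have YX : on_bodies (Defs.rot (- (k%:R * zeta))) Y = X.
  apply/matrixP => i c; case: (ord3P c) => ->; first exact: Yx; first exact: Yy.
  by rewrite Yz homothetic_z.
rewrite on_bodies_mulmx YX; case: f; last first.
  by rewrite expr0 /on_bodies trmx1 mulmx1.
rewrite expr1; apply/matrixP => i c.
have [Kx Ky Kz] := on_bodies_kappa X i.
by case: (ord3P c) => ->; rewrite ?Kx ?Ky ?Kz // homothetic_z oppr0.
Qed.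

Lemma expi0 : expi (0 : R) = 1.
Proof. by rewrite /expi cos0 sin0. Qed.

Lemma expiD (s t : R) : expi (s + t) = expi s * expi t.
Proof.
rewrite /expi cosD sinD; apply/eqP; rewrite eq_complex /= eqxx /=.
by apply/eqP; ring.
Qed.

(** * What the symmetries impose on a loop *)

Section consequences.
Variable x : R -> 'M[R]_(N, 3).
Hypotheses (px : forall t, x (t + 2 * pi) = x t)
  (sx : has_symmetries (Zn_Z2 n mu) x).

Lemma symmetric_vertical t i : x t i 2 = 0.
Proof.
(* The element is [kappa] alone, which gives z = - z. *)
have H : Zn_Z2 n mu (Defs.Sym (shift ^+ 0)%g (0%:R * zeta) true (- (0%:R * (n%:R * zeta)))).
  by exists 0%N, true.
have /(congr1 (fun f : R -> 'M[R]_(N, 3) => f t i 2)) := sx H; rewrite /Defs.act /=.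
rewrite on_bodies_mulmx periodic_sub_period //.
have [_ _ ->] := on_bodies_kappa (on_bodies (Defs.rot (- (0%:R * zeta)))
  (row_perm (shift ^+ 0)%g (x t))) i.
have [_ _ ->] := on_bodies_rot (- (0%:R * zeta)) (row_perm (shift ^+ 0)%g (x t)) i.
by rewrite mxE expg0 perm1; lra.
Qed.

Lemma symmetric_shift t i : planar (x t) (shift i) = expi zeta * planar (x t) i.
Proof.
have H : Zn_Z2 n mu (Defs.Sym (shift ^+ 1)%g (1%:R * zeta) false (- (1%:R * (n%:R * zeta)))).
  by exists 1%N, false.
have := sx H => /(congr1 (fun f : R -> 'M[R]_(N, 3) => f t)); rewrite /Defs.act /= expr0 mul1mx.
rewrite periodic_sub_period // => E.
have [] := on_bodies_rot (- (1%:R * zeta)) (row_perm (shift ^+ 1)%g (x t)) i.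
rewrite E !mxE expg1 mul1r => ex ey _.
rewrite /planar ex ey /spin_x /spin_y cosN sinN /expi.
(* The symmetry expresses each body as its successor turned by - zeta; multiplying by cos^2 + sin^2
   = 1 inverts this rotation. *)
have h := cos2Dsin2 zeta.
apply/eqP; rewrite eq_complex /=; apply/andP; split; apply/eqP.
  rewrite -[LHS]mul1r -h; ring.
by rewrite -[LHS]mul1r -h; ring.
Qed.

Lemma symmetric_center t i : label i = 0%N -> planar (x t) i = 0.
Proof.
(* The central body is fixed by [shift], so its position is unchanged under multiplication by
   [expi zeta], which is not 1. *)
move=> i0; have si : shift i = i.
  apply: val_inj; apply: (@addIn (mu == 0%R)); rewrite -/(label _) -/(label i).
  by rewrite label_shift i0.
have /eqP := symmetric_shift t i; rewrite si -[X in X == _]mul1r -subr_eq0 -mulrBl.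
rewrite mulf_eq0 => /orP[|/eqP //]; rewrite subr_eq0 => /eqP.
move=> /(congr1 (@complex.Re R)) /= /esym /eqP.
by rewrite (negPf (cos_zeta_neq1 hn)).
Qed.

Lemma symmetric_polygon t i1 i (j : nat) : label i1 = 1%N -> label i = j.+1 ->
  planar (x t) i = expi (j%:R * zeta) * planar (x t) i1.
Proof.
move=> h1 hi.
have -> : i = (shift ^+ j)%g i1.
  apply: val_inj; apply: (@addIn (mu == 0%R)); rewrite -/(label i) -/(label _).
  by rewrite label_shift_iter // -hi label_le_n.
elim: j {hi} => [|j IH]; first by rewrite expg0 perm1 mul0r expi0 mul1r.
by rewrite expgSr permM symmetric_shift IH mulrA -expiD -natr1 addrC mulrDl mul1r.
Qed.

End consequences.
End symmetries_of_homothetic_loops.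

(** * Kepler loops *)

Section kepler_loops.
Context {R : realType} (n : nat) (mu : R) (hn : (3 <= n)%N)
  (hmu : - s_ R n 1 < mu).
Local Notation N := (nbodies n mu).
Local Notation omega := (omega n mu).
Local Notation homothetic := (homothetic n mu).
Implicit Types e th t : R.

(** The complex factor a + ib by which the polygon is multiplied: the point on the ellipse, turned
    by [th] and seen in the rotating frame. *)
Definition kepler_a e th t := spin_x (th - t) (ell_x e t) (ell_y e t).
Definition kepler_b e th t := spin_y (th - t) (ell_x e t) (ell_y e t).
Definition kepler_a1 e th t :=
  spin_x (th - t) (vel_x e t + ell_y e t) (vel_y e t - ell_x e t).
Definition kepler_b1 e th t :=
  spin_y (th - t) (vel_x e t + ell_y e t) (vel_y e t - ell_x e t).
(* The Kepler attraction together with the Coriolis and centrifugal terms. *)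
Definition acc_x e t :=
  - (ell_x e t * (focal_radius e t)^-1 ^+ 3) + vel_y e t + (vel_y e t - ell_x e t).
Definition acc_y e t :=
  - (ell_y e t * (focal_radius e t)^-1 ^+ 3) - vel_x e t - (vel_x e t + ell_y e t).
Definition kepler_a2 e th t := spin_x (th - t) (acc_x e t) (acc_y e t).
Definition kepler_b2 e th t := spin_y (th - t) (acc_x e t) (acc_y e t).

Definition kepler_fun e th t := homothetic (kepler_a e th t) (kepler_b e th t).

Lemma is_derive_kepler e th t : `|e| < 1 ->
  [/\ is_derive t 1 (kepler_a e th) (kepler_a1 e th t),
      is_derive t 1 (kepler_b e th) (kepler_b1 e th t),
      is_derive t 1 (kepler_a1 e th) (kepler_a2 e th t)
    & is_derive t 1 (kepler_b1 e th) (kepler_b2 e th t)].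
Proof.
move=> e1.
have dx := is_derive_ell_x t e1; have dy := is_derive_ell_y t e1.
have dv := is_derive_vel_x t e1; have dw := is_derive_vel_y t e1.
have d1 := is_deriveD dv dy; have d2 := is_deriveB dw dx.
split; [exact: is_derive_spin_x|exact: is_derive_spin_y|
  exact: (is_derive_spin_x th d1 d2)|exact: (is_derive_spin_y th d1 d2)].
Qed.

Lemma continuous_kepler_a2b2 e th : `|e| < 1 ->
  continuous (kepler_a2 e th) /\ continuous (kepler_b2 e th).
Proof.
move=> e1.
have dc (f df : R -> R) : (forall t, is_derive t 1 f (df t)) -> continuous f.
  by move=> d t; apply/differentiable_continuous/derivable1_diffP.
have cx := dc _ _ (fun t => is_derive_ell_x t e1).
have cy := dc _ _ (fun t => is_derive_ell_y t e1).
have cv := dc _ _ (fun t => is_derive_vel_x t e1).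
have cw := dc _ _ (fun t => is_derive_vel_y t e1).
have cr := dc _ _ (fun t => is_derive_focal_radiusV t e1).
have cax : continuous (acc_x e).
  move=> t; apply: cvgD; last by apply: cvgB; [exact: cw|exact: cx].
  apply: cvgD; last exact: cw.
  apply: cvgN; apply: cvgM; first exact: cx.
  exact: (cvgM (cr t) (cvgM (cr t) (cr t))).
have cay : continuous (acc_y e).
  move=> t; apply: cvgB; last by apply: cvgD; [exact: cv|exact: cy].
  apply: cvgB; last exact: cv.
  apply: cvgN; apply: cvgM; first exact: cy.
  exact: (cvgM (cr t) (cvgM (cr t) (cr t))).
by split; [exact: continuous_spin_x|exact: continuous_spin_y].
Qed.

Lemma kepler_periodic e th t : `|e| <= 1 ->
  kepler_a e th (t + 2 * pi) = kepler_a e th t /\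
  kepler_b e th (t + 2 * pi) = kepler_b e th t.
Proof.
move=> e1; rewrite /kepler_a /kepler_b ell_xD2pi // ell_yD2pi //.
have hc : cos (th - (t + 2 * pi)) = cos (th - t).
  by rewrite -(cos_add2pi (_ - (_ + _))); congr cos; ring.
have hs : sin (th - (t + 2 * pi)) = sin (th - t).
  by rewrite -(sin_add2pi (_ - (_ + _))); congr sin; ring.
by rewrite /spin_x /spin_y hc hs.
Qed.

Lemma is_derive_homothetic (a b da db : R -> R) :
  (forall t, is_derive t 1 a (da t)) -> (forall t, is_derive t 1 b (db t)) ->
  forall t : R, is_derive t 1 (fun s => homothetic (a s) (b s)) (homothetic (da t) (db t)).
Proof.
move=> ha hb t.
exact: (is_deriveD (is_derive_scale_mx _ (ha t)) (is_derive_scale_mx _ (hb t))).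
Qed.

Lemma continuous_homothetic (a b : R -> R) : continuous a -> continuous b ->
  continuous (fun s => homothetic (a s) (b s)).
Proof.
move=> ca cb t; apply: cvgD; apply: cvgZr_tmp; [exact: ca|exact: cb].
Qed.

Lemma is_derive_kepler_fun e th : `|e| < 1 ->
  (forall t : R, is_derive t 1 (kepler_fun e th)
     (homothetic (kepler_a1 e th t) (kepler_b1 e th t))) /\
  (forall t : R, is_derive t 1
     (fun s => homothetic (kepler_a1 e th s) (kepler_b1 e th s))
     (homothetic (kepler_a2 e th t) (kepler_b2 e th t))).
Proof.
move=> e1; split; apply: is_derive_homothetic => t;
  by have [] := is_derive_kepler th t e1.
Qed.

Lemma kepler_isH2 e th : `|e| < 1 -> isH2 (kepler_fun e th).
Proof.
move=> e1; have [d1 d2] := is_derive_kepler_fun th e1.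
apply: C2_isH2 d1 d2 _ => [t|].
  by have [ha hb] := kepler_periodic th t (ltW e1); rewrite /kepler_fun ha hb.
by have [] := continuous_kepler_a2b2 th e1; exact: continuous_homothetic.
Qed.

(* Meaningful only for [|e| < 1]. *)
Definition kepler_loop e th : H2 R N :=
  if pselect (isH2 (kepler_fun e th)) is left h then MkH2 h else const_loop 0.

Lemma kepler_loopE e th : `|e| < 1 -> loop (kepler_loop e th) = kepler_fun e th.
Proof. by rewrite /kepler_loop; case: pselect => // no /(kepler_isH2 th). Qed.

Lemma kepler_loop_derivatives e th : `|e| < 1 ->
  has_derivatives (kepler_loop e th) (kepler_fun e th)
    (fun t => homothetic (kepler_a1 e th t) (kepler_b1 e th t))
    (fun t => homothetic (kepler_a2 e th t) (kepler_b2 e th t)).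
Proof.
move=> e1; have [d1 d2] := is_derive_kepler_fun th e1.
rewrite /has_derivatives (kepler_loopE th e1); split; first by [].
  exact: derive1_val d1.
exact: derive1n2_val d1 d2.
Qed.

Lemma H2_ext (x y : H2 R N) : loop x = loop y -> x = y.
Proof.
case: x y => [x hx] [y hy] /= xy; move: hx; rewrite xy => hx.
by rewrite (Prop_irrelevance hx hy).
Qed.

Lemma kepler_loop_cvg {T : Type} (F : set_system T) {FF : Filter F}
    (e th : T -> R) (e0 th0 : R) : `|e0| < 1 ->
  e s @[s --> F] --> e0 -> th s @[s --> F] --> th0 ->
  kepler_loop (e s) (th s) @[s --> F] --> kepler_loop e0 th0.
Proof.
move=> e01 ce cth.
have e1 : \forall s \near F, `|e s| < 1 by apply: (cvgr_norm_lt _ ce).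
have e1' : \forall s \near F, `|e s| <= 1.
  by apply: filterS e1 => s; exact: ltW.
have hx := ell_x_cvg (FF := FF) ce e1' (ltW e01).
have hy := ell_y_cvg (FF := FF) ce e1' (ltW e01).
have hv := vel_x_cvg (FF := FF) ce e1' (ltW e01) e01.
have hw := vel_y_cvg (FF := FF) ce e1' (ltW e01) e01.
have hr := focal_radiusV_cvg (FF := FF) ce e1' (ltW e01) e01.
have hr3 : bounded_unif_cvg F (fun s t => (focal_radius (e s) t)^-1 ^+ 3)
    (fun t => (focal_radius e0 t)^-1 ^+ 3).
  exact: (bounded_unif_cvgM (FF := FF) hr (bounded_unif_cvgM (FF := FF) hr hr)).
have hp := bounded_unif_cvgD (FF := FF) hv hy; have hq := bounded_unif_cvgB (FF := FF) hw hx.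
have ax := bounded_unif_cvgD (FF := FF) (bounded_unif_cvgD (FF := FF)
  (bounded_unif_cvgN (FF := FF) (bounded_unif_cvgM (FF := FF) hx hr3)) hw) hq.
have ay := bounded_unif_cvgB (FF := FF) (bounded_unif_cvgB (FF := FF)
  (bounded_unif_cvgN (FF := FF) (bounded_unif_cvgM (FF := FF) hy hr3)) hv) hp.
pose P := polygon n mu; pose Q := on_bodies (Jbar R) P.
have hd : \forall s \near F, has_derivatives (kepler_loop (e s) (th s))
    (kepler_fun (e s) (th s))
    (fun t => homothetic (kepler_a1 (e s) (th s) t) (kepler_b1 (e s) (th s) t))
    (fun t => homothetic (kepler_a2 (e s) (th s) t) (kepler_b2 (e s) (th s) t)).
  by near=> s; apply: kepler_loop_derivatives; near: s.
apply: (h2_cvg hd (kepler_loop_derivatives th0 e01)) => eps eps0.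
- exact: (sqnorm_combination_cvg (FF := FF) P Q
    (spin_x_cvg (FF := FF) cth hx hy).1 (spin_y_cvg (FF := FF) cth hx hy).1 eps0).
- exact: (sqnorm_combination_cvg (FF := FF) P Q
    (spin_x_cvg (FF := FF) cth hp hq).1 (spin_y_cvg (FF := FF) cth hp hq).1 eps0).
- exact: (sqnorm_combination_cvg (FF := FF) P Q
    (spin_x_cvg (FF := FF) cth ax ay).1 (spin_y_cvg (FF := FF) cth ax ay).1 eps0).
Unshelve. all: by end_near. Qed.

Lemma sqr_kepler e th t : `|e| <= 1 ->
  kepler_a e th t ^+ 2 + kepler_b e th t ^+ 2 = focal_radius e t ^+ 2.
Proof. by move=> e1; rewrite sqr_norm_cos_sin sqr_focal_radius. Qed.

Lemma omega_gt0 : 0 < omega.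
Proof. by rewrite /Defs.omega; have := hmu; lra. Qed.

Lemma on_bodies_Jbar a b :
  on_bodies (Jbar R) (homothetic a b) = homothetic (- b) a.
Proof.
apply/matrixP => i k; rewrite on_bodiesE homothetic_x homothetic_y homothetic_z.
case: (ord3P k) => ->; rewrite ?homothetic_x ?homothetic_y ?homothetic_z
  /Jbar /mx3 !mxE /= /pos_x /pos_y /spin_x /spin_y; case: eqP => _; ring.
Qed.

Lemma on_bodies_massmx (A : 'M[R]_3) (x : 'M[R]_(N, 3)) :
  on_bodies A (massmx n mu *m x) = massmx n mu *m on_bodies A x.
Proof. by rewrite /on_bodies mulmxA. Qed.

Lemma kepler_sqr_gt0 e th t : `|e| < 1 ->
  0 < kepler_a e th t ^+ 2 + kepler_b e th t ^+ 2.
Proof. by move=> e1; rewrite sqr_kepler ?ltW // exprn_gt0 // focal_radius_gt0. Qed.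

Lemma kepler_newton e th t : `|e| < 1 ->
  newton (kepler_loop e th) (Num.sqrt omega) t.
Proof.
move=> e1; have [l d dd] := kepler_loop_derivatives th e1.
rewrite /newton dd d l /kepler_fun on_bodies_massmx on_bodies_Jbar.
rewrite gradient_homothetic ?kepler_sqr_gt0 // sqr_kepler ?ltW //.
rewrite sqrtr_sqr gtr0_norm ?focal_radius_gt0 //.
(* At this frequency the inertial, Coriolis and gradient terms all carry the factor [omega], and
   [massmx] comes out on the left; what remains is the Kepler equation in the rotating frame. *)
rewrite -mulrA -expr2 sqr_sqrtr ?ltW ?omega_gt0 //.
rewrite -scaleNr !scalemxAr -!mulmxDr !homotheticZ !homotheticD.
rewrite -[RHS](mulmx0 _ (massmx n mu)) -homothetic0.
congr (_ *m homothetic _ _);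
  rewrite /kepler_a /kepler_b /kepler_a1 /kepler_b1 /kepler_a2 /kepler_b2
    /acc_x /acc_y /spin_x /spin_y; ring.
Qed.

Lemma kepler_solution e th : `|e| < 1 ->
  solutions (Zn_Z2 n mu) (kepler_loop e th, Num.sqrt omega).
Proof.
move=> e1; have [l _ _] := kepler_loop_derivatives th e1.
have sym : has_symmetries (Zn_Z2 n mu) (loop (kepler_loop e th)).
  rewrite l; apply: homothetic_symmetries => // t;
  by have [] := kepler_periodic th t (ltW e1).
split=> //=; split.
- by rewrite sqrtr_gt0 omega_gt0.
- by move=> t; rewrite l; apply: homothetic_collision_free => //; exact: kepler_sqr_gt0.
- by apply: aeW => t; exact: kepler_newton.
- rewrite /Rintegral; under eq_integral => t _.
    rewrite l big1; last by move=> i _; rewrite homothetic_z.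
    over.
  by rewrite integral0.
Qed.

Lemma exists_noncentral_body : exists i j : 'I_N, i != j /\ (0 < label j)%N.
Proof.
have N1 : (1 < N)%N by apply: leq_trans (leq_addl _ _); exact: leq_trans hn.
exists (Ordinal (ltnW N1)), (Ordinal N1); split; first by rewrite -val_eqE.
by rewrite /label /=.
Qed.

(** The distance of a vertex from the centre is 1 - e at t = 0 and 1 + e at t = pi. *)
Lemma kepler_nonconstant e th : `|e| < 1 -> e != 0 ->
  ~ exists a, loop (kepler_loop e th) = cst a.
Proof.
move=> e1 e0 [c]; have [-> _ _] := kepler_loop_derivatives th e1 => E.
have [_ [j [_ j0]]] := exists_noncentral_body.
have rE t : c j 0 ^+ 2 + c j 1 ^+ 2 = focal_radius e t ^+ 2.
  rewrite -(sqr_kepler th) ?ltW // -[c]/(cst c t) -E /kepler_fun.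
  rewrite homothetic_x homothetic_y /pos_x /pos_y gtn_eqF //.
  exact: sqr_norm_cos_sin.
have a0 : anomaly e 0 = 0.
  by rewrite -[RHS](anomalyK 0 (ltW e1)) sin0 mulr0 subr0.
have api : anomaly e pi = pi.
  by rewrite -[RHS](anomalyK pi (ltW e1)) sinpi mulr0 subr0.
have := rE pi; rewrite (rE 0) /focal_radius a0 api cos0 cospi => h.
by move/eqP: e0; apply; lra.
Qed.

(** At e = 0 the anomaly is [t], so the orbit e^{it} is cancelled by the rotation of the frame and
    only the turn by [th] is left. *)
Lemma kepler_circular th :
  kepler_loop 0 th = const_loop (on_bodies (Defs.rot th) (polygon n mu)).
Proof.
have z1 : `|0 : R| < 1 by rewrite normr0.
apply: H2_ext; rewrite kepler_loopE //; apply/funext => t /=.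
have ax : kepler_a 0 th t = cos th.
  rewrite /kepler_a /ell_x /ell_y anomaly0 expr0n /= !subr0 sqrtr1 mul1r.
  by rewrite /spin_x cosB sinB -[RHS]mulr1 -(cos2Dsin2 t); ring.
have ay : kepler_b 0 th t = sin th.
  rewrite /kepler_b /ell_x /ell_y anomaly0 expr0n /= !subr0 sqrtr1 mul1r.
  by rewrite /spin_y cosB sinB -[RHS]mulr1 -(cos2Dsin2 t); ring.
rewrite /kepler_fun ax ay -homothetic10 /cst; apply/matrixP => i k.
have [rx ry rz] := on_bodies_rot th (homothetic 1 0) i.
case: (ord3P k) => ->; rewrite ?rx ?ry ?rz !(homothetic_x, homothetic_y, homothetic_z) //
  /pos_x /pos_y /spin_x /spin_y; case: eqP => _; ring.
Qed.

End kepler_loops.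

(** * The branch *)

Section global_branch.
Context {R : realType} (n : nat) (mu : R) (hn : (3 <= n)%N)
  (hmu : - s_ R n 1 < mu).
Local Notation N := (nbodies n mu).
Local Notation nu := (Num.sqrt (omega n mu)).
Local Notation H := (Zn_Z2 n mu).
Implicit Types e th : R.

Definition kepler_point e th : H2 R N * R := (kepler_loop n mu e th, nu).

Lemma kepler_point_cvg {T : Type} (F : set_system T) {FF : Filter F}
    (e th : T -> R) (e0 th0 : R) : `|e0| < 1 ->
  e s @[s --> F] --> e0 -> th s @[s --> F] --> th0 ->
  kepler_point (e s) (th s) @[s --> F] --> kepler_point e0 th0.
Proof.
move=> e01 ce cth.
have h1 := kepler_loop_cvg (n := n) (mu := mu) (FF := FF) e01 ce cth.
have h2 : (fun _ : T => nu) s @[s --> F] --> nu by exact: cvg_cst.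
exact: (cvg_pair h1 h2).
Qed.

Lemma kepler_nontrivial e th : `|e| < 1 -> e != 0 ->
  nontrivial_solutions H (kepler_point e th).
Proof.
move=> e1 e0; split; first exact: kepler_solution.
exact: kepler_nonconstant.
Qed.

(** Circular solutions are constant, hence trivial; letting e -> 0+ puts them both in the set whose
    component is the branch and in the closure that defines bifurcation. *)
Lemma closure_circular (B : set (H2 R N * R)) th :
  (forall e, 0 < e < 1 -> B (kepler_point e th)) -> closure B (kepler_point 0 th).
Proof.
move=> HB U nU.
have z1 : `|0 : R| < 1 by rewrite normr0.
have c : kepler_point e th @[e --> 0^'+] --> kepler_point 0 th.
  apply: kepler_point_cvg => //; last exact: cvg_cst.
  by apply: cvg_at_right_filter; exact: cvg_id.
have [e [Ue e01]] : exists e, U (kepler_point e th) /\ 0 < e < 1.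
  apply: (@filter_ex _ (0 : R)^'+); near=> e; split.
    by near: e; exact: c.
  by apply/andP; split; near: e; [exact: nbhs_right_gt|exact: nbhs_right_lt].
by exists (kepler_point e th); split => //; exact: HB.
Unshelve. all: by end_near. Qed.

Lemma itv01_norm e : 0 < e < 1 -> `|e| < 1 /\ e != 0.
Proof. by move=> /andP[e0 e1]; rewrite gtr0_norm ?gt_eqF. Qed.

Lemma kepler_in_solutions e th : `|e| < 1 ->
  (solutions H `&` closure (nontrivial_solutions H)) (kepler_point e th).
Proof.
move=> e1; split; first exact: kepler_solution.
have [->|e0] := eqVneq e 0; last first.
  by apply: subset_closure; exact: kepler_nontrivial.
by apply: closure_circular => e' /itv01_norm[? ?]; exact: kepler_nontrivial.
Qed.

Lemma circular_polygon :
  kepler_point 0 0 = (const_loop (polygon n mu), nu).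
Proof.
rewrite /kepler_point kepler_circular //; congr (const_loop _, _).
apply/matrixP => i k; have [rx ry rz] := on_bodies_rot 0 (polygon n mu) i.
by case: (ord3P k) => ->; rewrite ?rx ?ry ?rz ?spin_x0 ?spin_y0.
Qed.

Lemma kepler_branch e th : `|e| < 1 ->
  branch H (polygon n mu) nu (kepler_point e th).
Proof.
move=> e1; rewrite /branch -circular_polygon.
(* A segment in the (e, th) plane from the polygon at (0, 0). For e = 0 it runs along the rotation
   orbit, so every rotated polygon is reached. *)
pose f s := kepler_point (s * e) (s * th).
have se1 s : s \in `[0, 1]%R -> `|s * e| < 1.
  rewrite in_itv /= => /andP[s0 s1]; rewrite normrM ger0_norm //.
  by apply: le_lt_trans e1; exact: ler_piMl.
apply: (@connected_component_max _ _ (f @` `[0, 1]%classic)).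
- by exists 0; rewrite /f ?mul0r //= in_itv /= lexx ler01.
- by move=> _ [s s01 <-]; exact/kepler_in_solutions/se1.
- apply: connected_continuous_connected; first exact: segment_connected.
  apply: continuous_in_subspaceT => s; rewrite inE => s01.
  by apply: kepler_point_cvg; [exact: se1|..]; apply: cvgM => //; exact: cvg_cst.
- by exists 1; rewrite /f ?mul1r //= in_itv /= lexx ler01.
Qed.

Lemma polygon_bifurcates : bifurcates H (polygon n mu) nu.
Proof.
move=> th; rewrite -kepler_circular //=.
have z1 : `|0 : R| < 1 by rewrite normr0.
split; first exact: kepler_branch.
apply: closure_circular => e /itv01_norm[e1 e0].
by split; [exact: kepler_branch|exact: kepler_nontrivial].
Qed.

Lemma branch_ends_in_collision : ends_in_collision (branch H (polygon n mu) nu).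
Proof.
have n1 : `|1 : R| <= 1 by rewrite normr1.
(* At e = 1 the semi-minor axis is 0 and the ellipse is a segment of length 2 ending at the
   focus. *)
pose a := kepler_a (1 : R) 0; pose b := kepler_b (1 : R) 0.
have cE := continuous_anomaly n1.
exists (fun t => homothetic n mu (a t) (b t)); split.
- have cx : continuous (ell_x (1 : R)).
    move=> t; apply: cvgB; last exact: cvg_cst.
    by apply: (@cvg_comp _ _ _ _ (@cos R) _ _ _ (cE t)); exact: continuous_cos.
  have cy : continuous (ell_y (1 : R)).
    move=> t; apply: cvgM; first exact: cvg_cst.
    by apply: (@cvg_comp _ _ _ _ (@sin R) _ _ _ (cE t)); exact: continuous_sin.
  by apply: continuous_homothetic; [exact: continuous_spin_x|exact: continuous_spin_y].
- by move=> t; have [ha hb] := kepler_periodic 0 t n1; rewrite /a /b ha hb.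
(* At t = 0 the radius 1 - cos 0 vanishes and all bodies are at the origin, so any two distinct ones
   collide. *)
- have [i [j [ij _]]] := exists_noncentral_body mu hn.
  exists 0, i, j; split=> //.
  have E : anomaly (1 : R) 0 = 0.
    by rewrite -[RHS](anomalyK 0 n1) sin0 mulr0 subr0.
  have a0 : a 0 = 0.
    rewrite /a /kepler_a /spin_x /ell_x /ell_y E cos0 sin0; ring.
  have b0 : b 0 = 0.
    rewrite /b /kepler_b /spin_y /ell_x /ell_y E cos0 sin0; ring.
  by rewrite a0 b0 homothetic0 !row0.
move=> eps eps0.
pose P := polygon n mu; pose Q := on_bodies (Jbar R) P.
pose K := `|P| + `|Q| + 1.
have K0 : 0 < K by rewrite /K ltr_wpDl // addr_ge0.
pose d := eps / K; have d0 : 0 < d by rewrite divr_gt0.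
have ce : e @[e --> (1 : R)^'-] --> (1 : R).
  by apply: cvg_at_left_filter; exact: cvg_id.
have cth : (fun _ : R => 0 : R) e @[e --> (1 : R)^'-] --> (0 : R) by exact: cvg_cst.
have e0 : \forall e \near (1 : R)^'-, 0 < e by exact: nbhs_left_gt.
have e1 : \forall e \near (1 : R)^'-, e < 1 by exact: nbhs_left_lt.
have e1' : \forall e \near (1 : R)^'-, `|e| <= 1.
  by near=> e; rewrite gtr0_norm; [apply: ltW|]; near: e.
have hx := ell_x_cvg (FF := at_left_proper_filter 1) ce e1' n1.
have hy := ell_y_cvg (FF := at_left_proper_filter 1) ce e1' n1.
have [ca _] := spin_x_cvg (FF := at_left_proper_filter 1) cth hx hy.
have [cb _] := spin_y_cvg (FF := at_left_proper_filter 1) cth hx hy.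
have [e [e01 da db]] : exists e, [/\ `|e| < 1,
    forall t, `|kepler_a e 0 t - a t| < d & forall t, `|kepler_b e 0 t - b t| < d].
  apply: (@filter_ex _ (1 : R)^'-); near=> e; split.
  - by rewrite gtr0_norm; near: e.
  - by near: e; exact: ca.
  - by near: e; exact: cb.
exists (kepler_point e 0); first exact: kepler_branch.
move=> t; rewrite /= kepler_loopE // /kepler_fun /homothetic -/P -/Q.
have -> : kepler_a e 0 t *: P + kepler_b e 0 t *: Q - (a t *: P + b t *: Q) =
    (kepler_a e 0 t - a t) *: P + (kepler_b e 0 t - b t) *: Q.
  by rewrite opprD addrACA -!scalerBl.
apply: le_lt_trans (ler_normD _ _) _; rewrite !normrZ.
have h1 := ler_wpM2r (normr_ge0 P) (ltW (da t)).
have h2 := ler_wpM2r (normr_ge0 Q) (ltW (db t)).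
apply: le_lt_trans (lerD h1 h2) _.
have -> : eps = d * `|P| + d * `|Q| + d.
  by rewrite -!mulrDr -[X in _ + X]mulr1 -mulrDr divfK ?gt_eqF.
by rewrite ltrDl.
Unshelve. all: by end_near. Qed.

End global_branch.

Theorem mainTheorem4 (R : realType) (n : nat) (mu : R)
    (hn : (3 <= n)%N) (hmu : - s_ R n 1 < mu) :
  has_global_branch (Zn_Z2 n mu) (polygon n mu) (Num.sqrt (omega n mu)) /\
  forall p, branch (Zn_Z2 n mu) (polygon n mu) (Num.sqrt (omega n mu)) p ->
    forall t : R,
      [/\ forall i, loop p.1 t i 2 = 0,
          forall i, label i = 0%N -> planar (loop p.1 t) i = 0
        & forall (i1 i : 'I_(nbodies n mu)) (j : nat),
            label i1 = 1%N -> label i = j.+1 ->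
            planar (loop p.1 t) i = expi (j%:R * zeta R n) * planar (loop p.1 t) i1].
Proof.
split; first by split; [exact: polygon_bifurcates|left; right; exact: branch_ends_in_collision].
(* Every point of the component, on the Kepler family or not, is a solution with the symmetries, and
   these imply the stated form. *)
move=> p /connected_component_sub [[_ sp] _] t.
have [pp _ _ _ _] := loop_isH2 p.1.
split=> [i|i i0|i1 i j i11 ij].
- exact: symmetric_vertical.
- exact: symmetric_center.
- exact: symmetric_polygon.
Qed.
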